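(* Let $p$ be a prime, $R$ a perfect $\mathbb{F}_p$-algebra equipped with a power-multiplicative norm $\alpha$ with $\alpha\le1$, and equip $W(R)$ with the power-multiplicative norm $\lambda(\alpha)$. Let $\pi=\sum_{i\ge0}p^i[\overline{\pi_i}]\in W(R)$ with $\alpha(\overline{\pi_0})\le p^{-1}$ and $\overline{\pi_1}$ a unit of $R$. Then the map $\mathcal{M}(R)\times[0,1]\to\mathcal{M}(W(R))$, $(\gamma,t)\mapsto H(\gamma,\pi,t)$, is continuous.
   Context: Seminorms are nonarchimedean; power-multiplicative: $\alpha(1)\le1$, $\alpha(gh)\le\alpha(g)\alpha(h)$, $\alpha(g^2)=\alpha(g)^2$; multiplicative: $\alpha(1)\le1$, $\alpha(gh)=\alpha(g)\alpha(h)$. For a ring $A$ with a submultiplicative norm $|\cdot|$, $\mathcal{M}(A)$ is the set of multiplicative seminorms on $A$ bounded pointwise by $|\cdot|$, topologized as a subspace of $\prod_{a\in A}[0,|a|]$. $W(R)$: $p$-typical Witt vectors, multiplicative Teichmüller map $[\cdot]$, unique expansions $\sum_{i\ge0}p^i[\overline{x_i}]$. For a power-multiplicative seminorm $\gamma\le1$ on $R$, $\lambda(\gamma)(\sum p^i[\overline{x_i}])=\max_ip^{-i}\gamma(\overline{x_i})$, and for $t\in[0,1]$ (assuming $\gamma(\overline{\pi_0})\le p^{-1}$), $H(\gamma,\pi,t)(x)=\inf\max_i\{(t/p)^i\lambda(\gamma)(a_i)\}$ over all finitely supported sequences $a_i\in W(R)$ with $\sum_ia_i\pi^i=x$. For $\gamma\in\mathcal{M}(R)$,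 $H(\gamma,\pi,t)$ is a multiplicative seminorm bounded by $\lambda(\gamma)\le\lambda(\alpha)$, hence a point of $\mathcal{M}(W(R))$. *)

(* Defs.v *)
From HB Require Import structures.
From mathcomp Require Import all_boot all_order all_algebra.
From mathcomp Require Import finmap.
From mathcomp Require Import monalg.
From mathcomp Require Import all_classical all_reals all_analysis.
From mathcomp Require Import zify ring.

Set Implicit Arguments.
Unset Strict Implicit.
Unset Printing Implicit Defensive.

Import Order.TTheory GRing.Theory Num.Theory.
Import numFieldTopology.Exports numFieldNormedType.Exports.
Local Open Scope ring_scope.

(* Polynomials over int in variables indexed by I.  zeval v substitutes v i for
   the variable i.  The heavy constants are locked because failing conversion
   checks would otherwise unfold polynomial arithmetic. *)
Definition zpoly (I : choiceType) := {malg int[{cmonom I}]}.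
HB.instance Definition _ (I : choiceType) := GRing.ComNzRing.on (zpoly I).

HB.lock Definition zvar (I : choiceType) (i : I) : zpoly I := << ucm i >>.
Arguments zvar {I} i.

Definition meval (I : choiceType) (R : comPzRingType) (v : I -> R)
    (m : {cmonom I}) : R :=
  \prod_(i <- finsupp m) v i ^+ m i.

HB.lock Definition zeval (I : choiceType) (R : comPzRingType) (v : I -> R)
    (f : zpoly I) : R :=
  \sum_(m <- msupp f) meval v m *~ f@_m.
Arguments zeval {I R} v f.

Section IntegerPolynomials.
Context {I : choiceType}.
Local Notation zpoly := (zpoly I).

(* Exact division by d when all coefficients are multiples of d. *)
Definition zdivn (d : nat) (f : zpoly) : zpoly :=
  \sum_(m <- msupp f) << (f@_m %/ d%:Z)%Z *g m >>.

Section Eval.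
Context (R : comPzRingType) (v : I -> R).

Lemma mevalw (d : {fset I}) (m : {cmonom I}) : (finsupp m `<=` d)%fset ->
  meval v m = \prod_(i <- d) v i ^+ m i.
Proof.
move=> le; rewrite /meval; apply: big_fset_incl => // i _.
by rewrite -cmE_eq0 => /eqP ->; rewrite expr0.
Qed.

Lemma meval1 : meval v mone = 1.
Proof. by rewrite /meval mdom1 big_seq_fset0. Qed.

Lemma mevalM (m1 m2 : {cmonom I}) :
  meval v (mmul m1 m2) = meval v m1 * meval v m2.
Proof.
rewrite (@mevalw (finsupp m1 `|` finsupp m2)%fset) ?mdomD//.
rewrite (@mevalw (finsupp m1 `|` finsupp m2)%fset m1) ?fsubsetUl//.
rewrite (@mevalw (finsupp m1 `|` finsupp m2)%fset m2) ?fsubsetUr//.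
by rewrite -big_split; apply: eq_bigr => i _; rewrite cmM exprD.
Qed.

Lemma zevalw (d : {fset {cmonom I}}) (f : zpoly) : (msupp f `<=` d)%fset ->
  zeval v f = \sum_(m <- d) meval v m *~ f@_m.
Proof.
move=> le; rewrite zeval.unlock; apply: big_fset_incl => // m _.
by move/mcoeff_outdom ->; rewrite mulr0z.
Qed.

Lemma zevalU (c : int) (m : {cmonom I}) : zeval v << c *g m >> = meval v m *~ c.
Proof. by rewrite (zevalw msuppU_le) big_seq_fset1 mcoeffUU. Qed.

Lemma zevalD : {morph zeval v : f g / f + g}.
Proof.
move=> f g.
rewrite (zevalw (msuppD_le f g)) (zevalw (fsubsetUl (msupp f) (msupp g))).
rewrite (zevalw (fsubsetUr (msupp f) (msupp g))) -big_split.
by apply: eq_bigr => m _; rewrite mcoeffD mulrzDr.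
Qed.

Lemma zeval0 : zeval v 0 = 0.
Proof. by rewrite zeval.unlock msupp0 big_seq_fset0. Qed.

Lemma zeval1 : zeval v 1 = 1.
Proof. by rewrite zevalU meval1. Qed.

Lemma zevalN : {morph zeval v : f / - f}.
Proof.
by move=> f; apply: (addrI (zeval v f)); rewrite -zevalD !subrr zeval0.
Qed.

Lemma zeval_sum (J : Type) (r : seq J) (F : J -> zpoly) :
  zeval v (\sum_(j <- r) F j) = \sum_(j <- r) zeval v (F j).
Proof. exact: (big_morph _ zevalD zeval0). Qed.

Lemma zevalM : {morph zeval v : f g / f * g}.
Proof.
move=> f g; rewrite malgME zeval_sum.
rewrite (zevalw (fsubset_refl (msupp f))) (zevalw (fsubset_refl (msupp g))).
rewrite mulr_suml; apply: eq_bigr => m _.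
rewrite zeval_sum mulr_sumr; apply: eq_bigr => k _.
by rewrite zevalU mevalM mulrzA mulrzAl mulrzAr mulrzAC.
Qed.

Lemma zeval_var i : zeval v (zvar i) = v i.
Proof. by rewrite zvar.unlock zevalU /meval mdomU big_seq_fset1 cmUU expr1. Qed.

Lemma zevalMn n : {morph zeval v : f / f *+ n}.
Proof.
by move=> f; elim: n => [|n IH]; rewrite ?mulr0n ?zeval0// !mulrS zevalD IH.
Qed.

Lemma zevalX n : {morph zeval v : f / f ^+ n}.
Proof.
by move=> f; elim: n => [|n IH]; rewrite ?expr0 ?zeval1// !exprS zevalM IH.
Qed.

Lemma zevalMz (c : int) : {morph zeval v : f / f *~ c}.
Proof.
by move=> f; case: c => n; rewrite ?NegzE ?mulrNz ?zevalN -!pmulrn zevalMn.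
Qed.
End Eval.

Lemma zvarE (m : {cmonom I}) : << m >> = meval zvar m :> zpoly.
Proof.
pose k := \big[mmul/mone]_(i <- finsupp m) expcmn (ucm i) (m i).
have expS i n : expcmn (ucm i) n.+1 = mmul (ucm i) (expcmn (ucm i) n).
  by case: n => [|n]; [rewrite /expcmn /= mulm1 | ].
have expE i n j : expcmn (ucm i) n j = (n * (i == j))%N.
  elim: n => [|n IH]; first by rewrite /expcmn /= cm1.
  by rewrite expS cmM IH cmU mulSn.
have -> : m = k.
  apply/eqP/cmP => j; rewrite /k.
  transitivity (\sum_(i <- finsupp m) m i * (i == j))%N; last first.
    have mj : {morph (fun x : {cmonom I} => x j) : x y / mmul x y >-> (x + y)%N}.
      by move=> x y; rewrite cmM.
    rewrite (big_morph (fun x : {cmonom I} => x j) mj (cm1 j)).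
    by apply: eq_bigr => i _; rewrite expE.
  case: (boolP (j \in finsupp m)) => jm.
    rewrite (big_fsetD1 j jm) /= eqxx muln1 big1_fset ?addn0// => i.
    by rewrite in_fsetD1 => /andP[/negPf -> _] _; rewrite muln0.
  rewrite big1_fset; first by apply/eqP; rewrite cmE_eq0.
  move=> i im _; case: eqP => [ij|_]; last by rewrite muln0.
  by rewrite ij (negPf jm) in im.
rewrite /k.
have mM : {morph (fun x : {cmonom I} => << x >> : zpoly) : x y / mmul x y >-> x * y}.
  by move=> x y; rewrite [RHS]fgmulUU mulr1.
have -> : meval zvar k = \prod_(i <- finsupp m) meval zvar (expcmn (ucm i) (m i)).
  exact: (big_morph _ (mevalM _) (meval1 _)).
rewrite (big_morph (fun x : {cmonom I} => << x >> : zpoly) mM (erefl _)).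
apply: eq_bigr => i _; elim: (m i) => [|n IH]; first by rewrite meval1.
rewrite expS mM mevalM IH; congr (_ * _).
by rewrite /meval mdomU big_seq_fset1 cmUU expr1 zvar.unlock.
Qed.

Lemma zpoly_zeval (f : zpoly) : zeval zvar f = f.
Proof.
rewrite zeval.unlock [RHS]monalgE; apply: eq_bigr => m _; rewrite -zvarE -mulrzl.
by rewrite -[f@_m in RHS]intz raddfMz /= mulrzl.
Qed.

Lemma zpoly_ind (P : zpoly -> Prop) :
  (forall i, P (zvar i)) -> P 1 -> P (- 1) ->
  (forall f g, P f -> P g -> P (f + g)) ->
  (forall f g, P f -> P g -> P (f * g)) -> forall f, P f.
Proof.
move=> PX P1 PN PD PM f; rewrite -(zpoly_zeval f) zeval.unlock.
have P0 : P 0 by rewrite -(subrr 1); apply: PD.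
apply: (big_ind P) => // m _.
have Pm : P (meval zvar m).
  apply: (big_ind P) => // i _; elim: (m i) => [|n IH]; first by rewrite expr0.
  by rewrite exprS; exact: PM (PX i) IH.
have Pn n : P (meval zvar m *+ n).
  elim: n => [|n IH]; first by rewrite mulr0n; exact: P0.
  by rewrite mulrS; apply: PD Pm IH.
case: (f@_m) => n; first exact: Pn.
by rewrite NegzE mulrNz -mulN1r; exact: PM PN (Pn _).
Qed.

Lemma zpoly_comp (R : comPzRingType) (w : I -> R)
  (h : zpoly -> R) : {morph h : f g / f + g} -> {morph h : f g / f * g} ->
  h 1 = 1 -> (forall i, h (zvar i) = w i) -> forall f, h f = zeval w f.
Proof.
move=> hD hM h1 hX.
have h0 : h 0 = 0 by apply: (addrI (h 0)); rewrite -hD !addr0.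
apply: zpoly_ind => [i|||f g IHf IHg|f g IHf IHg].
- by rewrite zeval_var.
- by rewrite zeval1.
- by apply: (addrI (h 1)); rewrite -hD subrr h0 zevalN zeval1 h1 subrr.
- by rewrite hD zevalD IHf IHg.
- by rewrite hM zevalM IHf IHg.
Qed.

Lemma zpolyMnI d (f g : zpoly) : (0 < d)%N -> f *+ d = g *+ d -> f = g.
Proof.
move=> d0 fg; apply/malgP => m; have := congr1 (mcoeff m) fg.
rewrite !mcoeffMn => /eqP; rewrite eqrMn2r (gtn_eqF d0) => /eqP.
exact.
Qed.

Lemma mcoeff_zdivn d (f : zpoly) m : (zdivn d f)@_m = (f@_m %/ d%:Z)%Z.
Proof.
have -> : (zdivn d f)@_m = \sum_(k <- msupp f) (f@_k %/ d%:Z)%Z *+ (k == m).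
  by rewrite /zdivn raddf_sum; apply: eq_bigr => k _; exact: mcoeffU.
have [mf|mf] := msuppP f m.
  rewrite (big_fsetD1 m mf) eqxx mulr1n big1_fset; first exact: addr0.
  move=> k; rewrite in_fsetD1 => /andP[/negPf km _] _.
  by rewrite km mulr0n.
rewrite div0z big1_fset // => k kf _.
have [km|_] := eqVneq k m; last exact: mulr0n.
by rewrite -km kf in mf.
Qed.

Lemma zdivnK d (f : zpoly) : (0 < d)%N -> zdivn d (f *+ d) = f.
Proof.
move=> d0; apply/malgP => m; rewrite mcoeff_zdivn mcoeffMn -mulr_natr natz.
by rewrite mulzK// -lt0n.
Qed.

End IntegerPolynomials.

(* The Witt polynomial w_n = \sum_(i <= n) p^i X_i^(p^(n-i)), evaluated at x. *)
HB.lock Definition ghost (p : nat) (A : comPzRingType) (n : nat) (x : nat -> A) : A :=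
  \sum_(i < n.+1) x i ^+ (p ^ (n - i)) *+ (p ^ i).
Arguments ghost p {A} n x.

(* w_n without its last term p^n X_n. *)
HB.lock Definition ghost_low (p : nat) (A : comPzRingType) (n : nat) (x : nat -> A) : A :=
  \sum_(i < n) x i ^+ (p ^ (n - i)) *+ (p ^ i).
Arguments ghost_low p {A} n x.

(* unghost p g is the sequence with n-th ghost component g n, solved recursively
   for its last entry; the division by p^n is exact as soon as
   g (n+1) = zfrob (g n) modulo p^(n+1), see unghostK (Dwork's lemma). *)
Fixpoint unghost_seq (p : nat) (I : choiceType) (g : nat -> zpoly I) (n : nat) :
    seq (zpoly I) :=
  if n is m.+1 then
    let s := unghost_seq p g m in
    rcons s (zdivn (p ^ m) (g m - ghost_low p m (nth 0 s)))
  else [::].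

HB.lock Definition unghost (p : nat) (I : choiceType) (g : nat -> zpoly I)
    (n : nat) : zpoly I := (unghost_seq p g n.+1)`_n.
Arguments unghost p {I} g n.

Section Ghost.
Context (p : nat) (pr : prime p).
Let p0 : (0 < p)%N := prime_gt0 pr.
Local Notation ghost := (ghost p).
Local Notation ghost_low := (ghost_low p).
Local Notation unghost := (unghost p).
Local Notation unghost_seq := (unghost_seq p).

Definition natdvd (A : comPzRingType) (d : nat) (a : A) :=
  exists b, a = b *+ d.

Section Congruences.
Context {A : comPzRingType}.
Implicit Types (a b c : A) (x y : nat -> A).

Lemma natdvd0 d : natdvd d (0 : A).
Proof. by exists 0; rewrite mul0rn. Qed.

Lemma natdvdD d a b : natdvd d a -> natdvd d b -> natdvd d (a + b).
Proof. by move=> [u ->] [v ->]; exists (u + v); rewrite mulrnDl. Qed.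

Lemma natdvdN d a : natdvd d a -> natdvd d (- a).
Proof. by move=> [u ->]; exists (- u); rewrite mulNrn. Qed.

Lemma natdvdM d a b : natdvd d a -> natdvd d (b * a).
Proof. by move=> [u ->]; exists (b * u); rewrite mulrnAr. Qed.

Lemma natdvdMn d e a : natdvd d a -> natdvd (d * e) (a *+ e).
Proof. by move=> [u ->]; exists u; rewrite mulrnA. Qed.

Lemma natdvd_sum d (J : Type) (r : seq J) (P : pred J) (F : J -> A) :
  (forall j, P j -> natdvd d (F j)) -> natdvd d (\sum_(j <- r | P j) F j).
Proof.
by move=> h; apply: (big_ind (natdvd d)) => //; [exact: natdvd0|exact: natdvdD].
Qed.

Lemma frobenius_add a b : natdvd p ((a + b) ^+ p - (a ^+ p + b ^+ p)).
Proof.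
case: p pr => // q prq.
rewrite exprDn big_ord_recl big_ord_recr /= !subn0 subnn expr0 !mulr1 bin0 binn.
rewrite expr0 mul1r !mulr1n addrCA addrK.
apply: natdvd_sum => i _; rewrite /bump /= add1n.
have /dvdnP[k ->] : (q.+1 %| 'C(q.+1, i.+1))%N.
  by apply: prime_dvd_bin => //=; rewrite ltnS.
by eexists; rewrite mulrnA.
Qed.

Lemma exprD_taylor a b n :
  exists c, (a + b) ^+ n = a ^+ n + (a ^+ n.-1 * b) *+ n + b ^+ 2 * c.
Proof.
elim: n => [|[|n] [c IH]]; first by exists 0; rewrite !expr0 mulr0n !addr0 mulr0 addr0.
  by exists 0; rewrite !expr1 expr0 mul1r mulr0 addr0.
exists (a ^+ n *+ n.+1 + (a + b) * c).
rewrite exprS IH /= !exprS !mulrS; ring.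
Qed.

Lemma frobenius_cong k a b :
  natdvd (p ^ k.+1) (a - b) -> natdvd (p ^ k.+2) (a ^+ p - b ^+ p).
Proof.
move=> [c ab]; have -> : a = b + c *+ p ^ k.+1 by rewrite -ab addrC subrK.
have [d ->] := exprD_taylor b (c *+ p ^ k.+1) p.
exists (b ^+ p.-1 * c + c ^+ 2 * d *+ (p ^ k)).
set q := (p ^ k)%N; have -> : (p ^ k.+1 = p * q)%N by rewrite expnS.
have -> : (p ^ k.+2 = p * (p * q))%N by rewrite !expnS.
ring.
Qed.

Lemma frobenius_cong_iter k a b :
  natdvd p (a - b) -> natdvd (p ^ k.+1) (a ^+ (p ^ k) - b ^+ (p ^ k)).
Proof.
move=> ab; elim: k => [|k IH]; first by rewrite expn1 expn0 !expr1.
have E c : c ^+ (p ^ k.+1) = (c ^+ (p ^ k)) ^+ p by rewrite expnSr exprM.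
by rewrite !E; exact: frobenius_cong.
Qed.

Lemma ghost_cong n x y : (forall i, (i <= n)%N -> natdvd p (x i - y i)) ->
  natdvd (p ^ n.+1) (ghost n x - ghost n y).
Proof.
move=> xy; rewrite ghost.unlock -sumrB; apply: natdvd_sum => i _.
rewrite -mulrnBl; have -> : (p ^ n.+1 = p ^ (n - i).+1 * p ^ i)%N.
  by rewrite -expnD addSn subnK// -ltnS.
by apply: natdvdMn; apply: frobenius_cong_iter; apply: xy; rewrite -ltnS.
Qed.

Lemma ghostS n x :
  ghost n.+1 x = ghost n (fun i => x i ^+ p) + x n.+1 *+ p ^ n.+1.
Proof.
rewrite ghost.unlock big_ord_recr /= subnn expn0 expr1; congr (_ + _).
apply: eq_bigr => i _; rewrite -exprM -expnS subSn//.
by rewrite -ltnS.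
Qed.

Lemma ghostSl n x :
  ghost n.+1 x = x 0%N ^+ (p ^ n.+1) + ghost n (fun i => x i.+1) *+ p.
Proof.
rewrite ghost.unlock big_ord_recl /= subn0 expn0 mulr1n; congr (_ + _).
rewrite -sumrMnl; apply: eq_bigr => i _; rewrite /bump /= add1n subSS.
by rewrite -mulrnA expnSr.
Qed.

Lemma frobenius_liftD a b a' b' : natdvd p (a' - a ^+ p) ->
  natdvd p (b' - b ^+ p) -> natdvd p (a' + b' - (a + b) ^+ p).
Proof.
move=> ha hb; have -> : a' + b' - (a + b) ^+ p = (a' - a ^+ p) + (b' - b ^+ p)
    - ((a + b) ^+ p - (a ^+ p + b ^+ p)) by ring.
apply: natdvdD; first exact: natdvdD.
by apply: natdvdN; exact: frobenius_add.
Qed.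

Lemma frobenius_liftM a b a' b' : natdvd p (a' - a ^+ p) ->
  natdvd p (b' - b ^+ p) -> natdvd p (a' * b' - (a * b) ^+ p).
Proof.
move=> ha hb; have -> : a' * b' - (a * b) ^+ p
    = b' * (a' - a ^+ p) + a ^+ p * (b' - b ^+ p) by rewrite exprMn; ring.
by apply: natdvdD; apply: natdvdM.
Qed.

Lemma ghostE n x : ghost n x = ghost_low n x + x n *+ p ^ n.
Proof. by rewrite ghost.unlock ghost_low.unlock big_ord_recr /= subnn expn0 expr1. Qed.

Lemma ghost_lowS n x : ghost_low n.+1 x = ghost n (fun i => x i ^+ p).
Proof.
rewrite ghost.unlock ghost_low.unlock.
apply: eq_bigr => i _; rewrite -exprM -expnS subSn//.
by rewrite -ltnS.
Qed.

Lemma eq_ghost_low n x y : (forall i, (i < n)%N -> x i = y i) ->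
  ghost_low n x = ghost_low n y.
Proof. by move=> xy; rewrite ?ghost.unlock ?ghost_low.unlock; apply: eq_bigr => i _; rewrite xy. Qed.

Lemma ghost_low_cong n x y : (forall i, (i < n)%N -> natdvd p (x i - y i)) ->
  natdvd (p ^ n.+1) (ghost_low n x - ghost_low n y).
Proof.
move=> xy; rewrite ghost_low.unlock -sumrB; apply: natdvd_sum => i _.
rewrite -mulrnBl; have -> : (p ^ n.+1 = p ^ (n - i).+1 * p ^ i)%N.
  by rewrite -expnD addSn subnK// ltnW.
by apply: natdvdMn; apply: frobenius_cong_iter; apply: xy.
Qed.

Lemma ghost_subE n x y : (x n - y n) *+ p ^ n =
  (ghost n x - ghost n y) - (ghost_low n x - ghost_low n y).
Proof. rewrite !ghostE mulrnBl; ring. Qed.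

Lemma eq_ghost n x y : (forall i, (i <= n)%N -> x i = y i) ->
  ghost n x = ghost n y.
Proof. by move=> xy; rewrite ?ghost.unlock ?ghost_low.unlock; apply: eq_bigr => i _; rewrite xy// -ltnS. Qed.
End Congruences.

Section IntegralLifts.
Context {I : choiceType}.
Implicit Types (g x y : nat -> zpoly I).

Lemma ghost_inj_cong x y : (forall n, natdvd (p ^ n.+1) (ghost n x - ghost n y)) ->
  forall n, natdvd p (x n - y n).
Proof.
move=> xy; elim/ltn_ind => n IH.
have : natdvd (p ^ n.+1) ((x n - y n) *+ p ^ n).
  rewrite ghost_subE; apply: natdvdD; first exact: xy.
  by apply: natdvdN; apply: ghost_low_cong.
move=> [c]; rewrite expnS mulrnA => /zpolyMnI e; exists c; apply: e.
by rewrite expn_gt0 p0.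
Qed.

Lemma ghost_inj x y : (forall n, ghost n x = ghost n y) -> forall n, x n = y n.
Proof.
move=> xy; elim/ltn_ind => n IH; have := xy n.
rewrite !ghostE (eq_ghost_low IH) => /addrI /zpolyMnI; apply.
by rewrite expn_gt0 p0.
Qed.

Definition zfrob (f : zpoly I) : zpoly I := zeval (fun i => zvar i ^+ p) f.

Lemma zfrob_cong f : natdvd p (zfrob f - f ^+ p).
Proof.
move: f; apply: (@zpoly_ind I) => [i|||f g [u fu] [v gv]|f g [u fu] [v gv]].
- by rewrite /zfrob zeval_var subrr; exact: natdvd0.
- by rewrite /zfrob zeval1 expr1n subrr; exact: natdvd0.
- rewrite /zfrob zevalN zeval1; case: (even_prime pr) => [->|podd].
    by rewrite sqrrN expr1n -opprD; exists (- 1); rewrite mulNrn.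
  by rewrite -signr_odd podd expr1 subrr; exact: natdvd0.
- rewrite [zfrob _](zevalD _ f g).
  by apply: frobenius_liftD; [exists u | exists v].
- rewrite [zfrob _](zevalM _ f g).
  by apply: frobenius_liftM; [exists u | exists v].
Qed.

Lemma size_unghost_seq g n : size (unghost_seq g n) = n.
Proof. by elim: n => //= n IH; rewrite size_rcons IH. Qed.

Lemma nth_unghost_seq g n i : (i < n)%N -> (unghost_seq g n)`_i = unghost g i.
Proof.
rewrite unghost.unlock; elim: n => // n IH; rewrite ltnS leq_eqVlt => /orP[/eqP->//|i_n].
by rewrite -(IH i_n) /= nth_rcons size_unghost_seq i_n.
Qed.

Lemma unghostE g n :
  unghost g n = zdivn (p ^ n) (g n - ghost_low n (unghost g)).
Proof.
rewrite {1}unghost.unlock /= nth_rcons size_unghost_seq ltnn eqxx.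
rewrite (@eq_ghost_low _ n _ (unghost g)) => [|i i_n]; first by [].
exact: nth_unghost_seq.
Qed.

Lemma unghostK g : (forall n, natdvd (p ^ n.+1) (g n.+1 - zfrob (g n))) ->
  forall n, ghost n (unghost g) = g n.
Proof.
move=> gdvd; elim/ltn_ind => n IH.
suff [c gc] : natdvd (p ^ n) (g n - ghost_low n (unghost g)).
  rewrite ghostE unghostE gc zdivnK ?expn_gt0 ?p0// -gc.
  by rewrite addrC subrK.
case: n IH => [|n] IH.
  by rewrite ghost_low.unlock big_ord0 subr0; exists (g 0%N).
rewrite ghost_lowS.
have gE : zfrob (g n) = ghost n (fun i => zfrob (unghost g i)).
  rewrite -IH// ghost.unlock /zfrob zeval_sum; apply: eq_bigr => i _.
  by rewrite zevalMn zevalX.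
rewrite -(subrK (zfrob (g n)) (g n.+1)) -addrA.
apply: natdvdD; first exact: gdvd.
by rewrite gE; apply: ghost_cong => i _; exact: zfrob_cong.
Qed.

Lemma zfrob_ghost_var (v : nat -> I) n :
  natdvd (p ^ n.+1)
    (ghost n.+1 (fun i => zvar (v i)) - zfrob (ghost n (fun i => zvar (v i)))).
Proof.
rewrite ghostS; suff -> : zfrob (ghost n (fun i => zvar (v i)))
    = ghost n (fun i => zvar (v i) ^+ p).
  by rewrite addrAC subrr add0r; exists (zvar (v n.+1)).
rewrite /zfrob ghost.unlock zeval_sum; apply: eq_bigr => i _.
by rewrite zevalMn zevalX zeval_var.
Qed.
End IntegralLifts.
End Ghost.

Lemma zeval_zeval (I J : choiceType) (R : comPzRingType) (v : J -> R)
    (w : I -> zpoly J) (f : zpoly I) :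
  zeval v (zeval w f) = zeval (fun i => zeval v (w i)) f.
Proof.
apply: (@zpoly_comp I R _ (fun f => zeval v (zeval w f))).
- by move=> a b; rewrite !zevalD.
- by move=> a b; rewrite !zevalM.
- by rewrite !zeval1.
- by move=> i; rewrite zeval_var.
Qed.

Lemma zeval_ghost (p : nat) (I : choiceType) (R : comPzRingType) (v : I -> R)
    (x : nat -> zpoly I) n :
  zeval v (ghost p n x) = ghost p n (fun i => zeval v (x i)).
Proof.
rewrite ghost.unlock zeval_sum; apply: eq_bigr => i _.
by rewrite zevalMn zevalX.
Qed.

Section WittPolynomials.
Context (p : nat) (pr : prime p).

Definition zvarX (i : nat) : zpoly (bool * nat)%type := zvar (false, i).
Definition zvarY (i : nat) : zpoly (bool * nat)%type := zvar (true, i).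

(* The universal polynomials of p-typical Witt vectors, determined by the ghost
   equations ghost_add_poly, ghost_opp_poly and ghost_mul_poly. *)
Definition witt_add_poly :=
  unghost p (fun n => ghost p n zvarX + ghost p n zvarY).
Definition witt_opp_poly := unghost p (fun n => - ghost p n zvarX).
Definition witt_mul_poly :=
  unghost p (fun n => ghost p n zvarX * ghost p n zvarY).

Lemma ghost_add_poly n :
  ghost p n witt_add_poly = ghost p n zvarX + ghost p n zvarY.
Proof.
apply: (unghostK pr) => m; rewrite [zfrob p _](zevalD _ _ _).
rewrite opprD addrACA; apply: natdvdD; exact: zfrob_ghost_var.
Qed.

Lemma ghost_opp_poly n : ghost p n witt_opp_poly = - ghost p n zvarX.
Proof.
apply: (unghostK pr) => m; rewrite [zfrob p _](zevalN _ _).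
rewrite -opprD; apply: natdvdN; exact: zfrob_ghost_var.
Qed.

Lemma ghost_mul_poly n :
  ghost p n witt_mul_poly = ghost p n zvarX * ghost p n zvarY.
Proof.
apply: (unghostK pr) => m; rewrite [zfrob p _](zevalM _ _ _).
have mulB (A : comPzRingType) (a b c d : A) :
  a * b - c * d = b * (a - c) + c * (b - d) by ring.
rewrite mulB; apply: natdvdD; apply: natdvdM; exact: zfrob_ghost_var.
Qed.

Section Operations.
Context {R : comPzRingType}.
Implicit Types x y z : nat -> R.

Definition wpair x y (bi : bool * nat) : R :=
  if bi.1 then y bi.2 else x bi.2.

Definition wadd x y n := zeval (wpair x y) (witt_add_poly n).
Definition wopp x n := zeval (wpair x x) (witt_opp_poly n).
Definition wmul x y n := zeval (wpair x y) (witt_mul_poly n).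
Definition wteich (r : R) (n : nat) : R := if n is 0 then r else 0.
Definition wzero (n : nat) : R := 0.
Definition wone := wteich 1.
(* Verschiebung. *)
Definition wshift x (n : nat) : R := if n is m.+1 then x m else 0.

Lemma ghost_wadd x y n : ghost p n (wadd x y) = ghost p n x + ghost p n y.
Proof.
have gen (S X Y : nat -> zpoly (bool * nat)%type) v :
    ghost p n S = ghost p n X + ghost p n Y ->
    (forall i, zeval v (X i) = x i) -> (forall i, zeval v (Y i) = y i) ->
    ghost p n (fun i => zeval v (S i)) = ghost p n x + ghost p n y.
  move=> e Xx Yy; rewrite -(zeval_ghost p v S).
  rewrite e.
  rewrite zevalD.
  rewrite (zeval_ghost p v X).
  rewrite (zeval_ghost p v Y).
  congr (_ + _); apply: eq_ghost => i _; [exact: Xx | exact: Yy].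
exact: (gen _ _ _ (wpair x y) (ghost_add_poly n)
  (fun i => zeval_var _ (false, i)) (fun i => zeval_var _ (true, i))).
Qed.

Lemma ghost_wopp x n : ghost p n (wopp x) = - ghost p n x.
Proof.
have gen (S X : nat -> zpoly (bool * nat)%type) v :
    ghost p n S = - ghost p n X -> (forall i, zeval v (X i) = x i) ->
    ghost p n (fun i => zeval v (S i)) = - ghost p n x.
  move=> e Xx; rewrite -(zeval_ghost p v S) e zevalN (zeval_ghost p v X).
  congr (- _); apply: eq_ghost => i _; exact: Xx.
exact: (gen _ _ (wpair x x) (ghost_opp_poly n)
  (fun i => zeval_var _ (false, i))).
Qed.

Lemma ghost_wmul x y n : ghost p n (wmul x y) = ghost p n x * ghost p n y.
Proof.
have gen (S X Y : nat -> zpoly (bool * nat)%type) v :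
    ghost p n S = ghost p n X * ghost p n Y ->
    (forall i, zeval v (X i) = x i) -> (forall i, zeval v (Y i) = y i) ->
    ghost p n (fun i => zeval v (S i)) = ghost p n x * ghost p n y.
  move=> e Xx Yy; rewrite -(zeval_ghost p v S) e zevalM (zeval_ghost p v X) (zeval_ghost p v Y).
  congr (_ * _); apply: eq_ghost => i _; [exact: Xx | exact: Yy].
exact: (gen _ _ _ (wpair x y) (ghost_mul_poly n)
  (fun i => zeval_var _ (false, i)) (fun i => zeval_var _ (true, i))).
Qed.

Lemma expr0_pow n : (0 : R) ^+ (p ^ n) = 0.
Proof. by rewrite expr0n expn_eq0 (gtn_eqF (prime_gt0 pr)). Qed.

Lemma ghost_wteich r n : ghost p n (wteich r) = r ^+ (p ^ n).
Proof.
rewrite ghost.unlock big_ord_recl /= subn0 expn0 mulr1n big1 ?addr0// => i _.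
by rewrite expr0_pow mul0rn.
Qed.

Lemma ghost_wone n : ghost p n wone = 1.
Proof. by rewrite ghost_wteich expr1n. Qed.

Lemma ghost_wzero n : ghost p n wzero = 0.
Proof. by rewrite ghost.unlock big1// => i _; rewrite expr0_pow mul0rn. Qed.

Lemma ghost_wshift0 x : ghost p 0 (wshift x) = 0.
Proof. by rewrite ghost.unlock big_ord1 expn0 expr1 mulr1n. Qed.

Lemma ghost_wshiftS x n : ghost p n.+1 (wshift x) = ghost p n x *+ p.
Proof. by rewrite ghostSl /= expr0_pow add0r. Qed.
End Operations.

Section Transfer.
Context {I : choiceType} {R : comPzRingType} (v : I -> R).
Implicit Types x y : nat -> zpoly I.
Let ev x n := zeval v (x n).

Lemma zeval_wadd x y : ev (wadd x y) = wadd (ev x) (ev y).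
Proof.
apply/funext => n; rewrite /ev zeval_zeval.
by congr (zeval _ _); apply/funext => -[[] i].
Qed.

Lemma zeval_wopp x : ev (wopp x) = wopp (ev x).
Proof.
apply/funext => n; rewrite /ev zeval_zeval.
by congr (zeval _ _); apply/funext => -[[] i].
Qed.

Lemma zeval_wmul x y : ev (wmul x y) = wmul (ev x) (ev y).
Proof.
apply/funext => n; rewrite /ev zeval_zeval.
by congr (zeval _ _); apply/funext => -[[] i].
Qed.

Lemma zeval_wteich r : ev (wteich r) = wteich (zeval v r).
Proof. by apply/funext => -[|n] //; rewrite /ev zeval0. Qed.

Lemma zeval_wzero : ev wzero = wzero.
Proof. by apply/funext => n; rewrite /ev zeval0. Qed.

Lemma zeval_wone : ev wone = wone.
Proof. by rewrite /wone zeval_wteich zeval1. Qed.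

Lemma zeval_wshift x : ev (wshift x) = wshift (ev x).
Proof. by apply/funext => -[|n] //; rewrite /ev zeval0. Qed.
End Transfer.

Section RingLaws.
Context {R : comPzRingType}.
Implicit Types x y z : nat -> R.

Let X x n : zpoly R := zvar (x n).
Let ev (x : nat -> zpoly R) n : R := zeval id (x n).

Lemma evX x : x = ev (X x).
Proof. by apply/funext => n; rewrite /ev zeval_var. Qed.

Lemma ev_ghost (x y : nat -> zpoly R) :
  (forall n, ghost p n x = ghost p n y) -> ev x = ev y.
Proof. by move=> h; apply/funext => n; rewrite /ev (ghost_inj pr h). Qed.

Lemma waddA : associative (@wadd R).
Proof.
move=> x y z; rewrite (evX x) (evX y) (evX z) -!zeval_wadd.
by apply: ev_ghost => n; rewrite !ghost_wadd addrA.
Qed.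

Lemma waddC : commutative (@wadd R).
Proof.
move=> x y; rewrite (evX x) (evX y) -!zeval_wadd.
by apply: ev_ghost => n; rewrite !ghost_wadd addrC.
Qed.

Lemma wadd0 : left_id wzero (@wadd R).
Proof.
move=> x; rewrite (evX x) -(zeval_wzero id) -!zeval_wadd.
by apply: ev_ghost => n; rewrite !ghost_wadd ghost_wzero add0r.
Qed.

Lemma waddN : left_inverse wzero wopp (@wadd R).
Proof.
move=> x; rewrite (evX x) -(zeval_wzero id) -zeval_wopp -!zeval_wadd.
by apply: ev_ghost => n; rewrite !ghost_wadd ghost_wopp ghost_wzero addNr.
Qed.

Lemma wmulA : associative (@wmul R).
Proof.
move=> x y z; rewrite (evX x) (evX y) (evX z) -!zeval_wmul.
by apply: ev_ghost => n; rewrite !ghost_wmul mulrA.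
Qed.

Lemma wmulC : commutative (@wmul R).
Proof.
move=> x y; rewrite (evX x) (evX y) -!zeval_wmul.
by apply: ev_ghost => n; rewrite !ghost_wmul mulrC.
Qed.

Lemma wmul1 : left_id wone (@wmul R).
Proof.
move=> x; rewrite (evX x) -(zeval_wone id) -!zeval_wmul.
by apply: ev_ghost => n; rewrite !ghost_wmul ghost_wone mul1r.
Qed.

Lemma wmulDl : left_distributive (@wmul R) wadd.
Proof.
move=> x y z; rewrite (evX x) (evX y) (evX z).
rewrite -!(zeval_wmul, zeval_wadd).
by apply: ev_ghost => n; rewrite !(ghost_wmul, ghost_wadd) mulrDl.
Qed.

Lemma wteichM (r s : R) : wteich (r * s) = wmul (wteich r) (wteich s).
Proof.
have E (t : R) : wteich t = ev (wteich (zvar t)).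
  by rewrite /ev zeval_wteich zeval_var.
have -> : wteich (r * s) = ev (wteich (zvar r * zvar s)).
  by rewrite /ev zeval_wteich zevalM !zeval_var.
rewrite !E -zeval_wmul; apply: ev_ghost => n.
by rewrite ghost_wmul !ghost_wteich exprMn.
Qed.

Lemma wadd_shift x :
  x = wadd (wteich (x 0%N)) (wshift (fun n => x n.+1)).
Proof.
have -> : wteich (x 0%N) = ev (wteich (zvar (x 0%N))).
  by rewrite /ev zeval_wteich zeval_var.
rewrite {1 3}(evX x) -zeval_wshift -zeval_wadd; apply: ev_ghost => -[|n].
  by rewrite ghost_wadd ghost_wteich ghost_wshift0 addr0 ghost.unlock big_ord1.
by rewrite ghost_wadd ghost_wteich ghost_wshiftS -ghostSl.
Qed.

Lemma wmuln_shift x : p%:R = 0 :> R ->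
  iter p (wadd x) wzero = wshift (fun n => x n ^+ p).
Proof.
move=> pR.
have iterE k : iter k (wadd x) wzero = ev (iter k (wadd (X x)) wzero).
  elim: k => [|k IH] /=; first by rewrite /ev zeval_wzero.
  by rewrite IH {1}(evX x) -zeval_wadd.
have ghost_iter k n :
    ghost p n (iter k (wadd (X x)) wzero) = ghost p n (X x) *+ k.
  elim: k => [|k IH] /=; first by rewrite ghost_wzero.
  by rewrite ghost_wadd IH -mulrS.
rewrite iterE; move: (ghost_iter p); set pX := iter p _ _ => gpX.
have -> : wshift (fun n => x n ^+ p) = ev (wshift (fun n => X x n ^+ p)).
  rewrite /ev zeval_wshift; congr wshift; apply/funext => n.
  by rewrite zevalX zeval_var.
have cong n : natdvd p (pX n - wshift (fun n => X x n ^+ p) n).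
  move: n; apply: (ghost_inj_cong pr) => -[|n]; rewrite gpX.
    by rewrite ghost_wshift0 subr0 expn1; eexists.
  rewrite ghost_wshiftS ghostS mulrnDl addrAC subrr add0r -mulrnA -expnSr.
  by eexists.
apply/funext => n; have [c /eqP] := cong n; rewrite subr_eq => /eqP e.
by rewrite /ev e zevalD zevalMn -mulr_natr pR mulr0 add0r.
Qed.
End RingLaws.
End WittPolynomials.

(* W(R), on sequences of Witt coordinates.  The primality proof is a parameter
   because the ring axioms depend on it. *)
Record witt (p : nat) (pr : prime p) (R : comPzRingType) :=
  Witt { wcoord : nat -> R }.
Arguments Witt {p pr R}.
Arguments wcoord {p pr R}.

Section WittVectors.
Context (p : nat) (pr : prime p) (R : comPzRingType).
Local Notation witt := (witt pr R).
Local Notation Witt := (@Witt p pr R).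

HB.instance Definition _ := gen_eqMixin witt.
HB.instance Definition _ := gen_choiceMixin witt.

Definition witt_add (x y : witt) := Witt (wadd p (wcoord x) (wcoord y)).
Definition witt_opp (x : witt) := Witt (wopp p (wcoord x)).
Definition witt_mul (x y : witt) := Witt (wmul p (wcoord x) (wcoord y)).

Lemma witt_eq (x y : witt) : wcoord x = wcoord y -> x = y.
Proof. by case: x y => [x] [y] /= ->. Qed.

Lemma witt_addA : associative witt_add.
Proof. by move=> x y z; apply: witt_eq; exact: (waddA pr). Qed.

Lemma witt_addC : commutative witt_add.
Proof. by move=> x y; apply: witt_eq; exact: (waddC pr). Qed.

Lemma witt_add0 : left_id (Witt wzero) witt_add.
Proof. by move=> x; apply: witt_eq; exact: (wadd0 pr). Qed.

Lemma witt_addN : left_inverse (Witt wzero) witt_opp witt_add.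
Proof. by move=> x; apply: witt_eq; exact: (waddN pr). Qed.

HB.instance Definition _ :=
  GRing.isZmodule.Build witt witt_addA witt_addC witt_add0 witt_addN.

Lemma witt_mulA : associative witt_mul.
Proof. by move=> x y z; apply: witt_eq; exact: (wmulA pr). Qed.

Lemma witt_mulC : commutative witt_mul.
Proof. by move=> x y; apply: witt_eq; exact: (wmulC pr). Qed.

Lemma witt_mul1 : left_id (Witt wone) witt_mul.
Proof. by move=> x; apply: witt_eq; exact: (wmul1 pr). Qed.

Lemma witt_mulDl : left_distributive witt_mul +%R.
Proof. by move=> x y z; apply: witt_eq; exact: (wmulDl pr). Qed.

HB.instance Definition _ := GRing.Zmodule_isComPzRing.Build witt
  witt_mulA witt_mulC witt_mul1 witt_mulDl.

Definition teich (r : R) : witt := Witt (wteich r).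

Lemma wcoord0 : wcoord 0 = wzero. Proof. by []. Qed.
Lemma wcoord1 : wcoord 1 = wone. Proof. by []. Qed.
Lemma wcoordD (x y : witt) : wcoord (x + y) = wadd p (wcoord x) (wcoord y).
Proof. by []. Qed.
Lemma wcoordN (x : witt) : wcoord (- x) = wopp p (wcoord x).
Proof. by []. Qed.
Lemma wcoordM (x y : witt) : wcoord (x * y) = wmul p (wcoord x) (wcoord y).
Proof. by []. Qed.

Lemma teichM : {morph teich : r s / r * s}.
Proof. by move=> r s; apply: witt_eq; exact: (wteichM pr). Qed.

Lemma teich1 : teich 1 = 1. Proof. by []. Qed.

Lemma ghostD n (x y : witt) :
  ghost p n (wcoord (x + y)) = ghost p n (wcoord x) + ghost p n (wcoord y).
Proof. exact: ghost_wadd. Qed.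

Lemma ghostM n (x y : witt) :
  ghost p n (wcoord (x * y)) = ghost p n (wcoord x) * ghost p n (wcoord y).
Proof. exact: ghost_wmul. Qed.

Lemma wcoord0D (x y : witt) : wcoord (x + y) 0%N = wcoord x 0%N + wcoord y 0%N.
Proof. by have := ghostD 0 x y; rewrite ghost.unlock !big_ord1 expn0 !expr1. Qed.

Definition perfect := bijective (fun r : R => r ^+ p).

(* The p^n-th root, unique when R is perfect (0 is a junk value). *)
Definition proot (n : nat) (r : R) : R := xget 0 [set s | s ^+ (p ^ n) = r]%classic.

(* Teichmueller digits: x = \sum_i p^i [tcoef x i], the i-th Witt coordinate of x
   being the p^i-th power of the i-th digit; see tcoef_expansion, tcoef_unique. *)
Definition tcoef (x : witt) (i : nat) : R := proot i (wcoord x i).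

Section Perfect.
Context (charR : p%:R = 0 :> R) (perfR : perfect).

Lemma expr_pow_inj n : injective (fun r : R => r ^+ (p ^ n)).
Proof.
elim: n => [|n IH] r s; first by rewrite expn0 !expr1.
by rewrite expnS !exprM => /IH; exact: (bij_inj perfR).
Qed.

Lemma prootK n r : proot n r ^+ (p ^ n) = r.
Proof.
suff [s sr] : exists s : R, s ^+ (p ^ n) = r by exact: (@xgetPex _ 0 [set s | s ^+ (p ^ n) = r]%classic (ex_intro _ s sr)).
case: perfR => g _ gK; elim: n r => [|n IH] r; first by exists r.
by have [s sr] := IH (g r); exists s; rewrite expnSr exprM sr gK.
Qed.

Lemma exprK_proot n r : proot n (r ^+ (p ^ n)) = r.
Proof. by apply: (@expr_pow_inj n); rewrite prootK. Qed.

Lemma wcoord_mulp (x : witt) :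
  wcoord (x *+ p) = wshift (fun n => wcoord x n ^+ p).
Proof.
have iterE k : wcoord (x *+ k) = iter k (wadd p (wcoord x)) wzero.
  by elim: k => [|k IH] //; rewrite mulrS wcoordD IH.
by rewrite iterE wmuln_shift.
Qed.

Lemma mulp_inj (x y : witt) : x *+ p = y *+ p -> x = y.
Proof.
move=> /(congr1 wcoord); rewrite !wcoord_mulp => e; apply/witt_eq/funext => n.
by have := congr1 (@^~ n.+1) e; exact: (bij_inj perfR).
Qed.

Definition wtail (x : witt) := Witt (fun n => proot 1 (wcoord x n.+1)).

Lemma teich_wtail x : x = teich (wcoord x 0%N) + wtail x *+ p.
Proof.
apply: witt_eq; rewrite wcoordD wcoord_mulp {1}(wadd_shift pr (wcoord x)).
congr (wadd _ _ (wshift _)); apply/funext => n.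
by have := prootK 1 (wcoord x n.+1); rewrite expn1.
Qed.

Lemma tcoef0 x : tcoef x 0 = wcoord x 0%N.
Proof. by have := exprK_proot 0 (wcoord x 0%N); rewrite expn0 expr1. Qed.

Lemma tcoef_wtail x i : tcoef (wtail x) i = tcoef x i.+1.
Proof.
apply: (@expr_pow_inj i.+1); rewrite prootK expnSr exprM prootK.
by have := prootK 1 (wcoord x i.+1); rewrite expn1.
Qed.

Lemma tcoef_expansion x n : exists y,
  x = \sum_(i < n) teich (tcoef x i) *+ p ^ i + y *+ p ^ n.
Proof.
elim: n x => [|n IH] x; first by exists x; rewrite big_ord0 add0r.
have [y yE] := IH (wtail x); exists y; rewrite {1}(teich_wtail x) {1}yE.
rewrite big_ord_recl tcoef0 expn0 mulr1n -addrA mulrnDl -mulrnA -expnSr.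
congr (_ + (_ + _)); rewrite -sumrMnl; apply: eq_bigr => i _.
by rewrite tcoef_wtail -mulrnA -expnSr.
Qed.

Lemma tcoef_unique x (c : nat -> R) :
  (forall n, exists y, x = \sum_(i < n) teich (c i) *+ p ^ i + y *+ p ^ n) ->
  forall i, c i = tcoef x i.
Proof.
move=> xc i; elim: i x c xc => [|i IH] x c xc.
  have [y ->] := xc 1%N; rewrite big_ord1 expn0 expn1 mulr1n.
  by rewrite tcoef0 wcoord0D wcoord_mulp addr0.
have c0 : c 0%N = wcoord x 0%N.
  have [y ->] := xc 1%N; rewrite big_ord1 expn0 expn1 mulr1n.
  by rewrite wcoord0D wcoord_mulp addr0.
rewrite -tcoef_wtail; apply: (IH _ (fun j => c j.+1)) => n.
have [y xE] := xc n.+1; exists y; apply: mulp_inj.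
apply: (addrI (teich (wcoord x 0%N))); rewrite -teich_wtail {1}xE.
rewrite big_ord_recl c0 expn0 mulr1n -addrA mulrnDl -mulrnA -expnSr.
congr (_ + (_ + _)); rewrite -sumrMnl; apply: eq_bigr => j _.
by rewrite -mulrnA -expnSr.
Qed.
End Perfect.
End WittVectors.

Local Open Scope classical_set_scope.

Section Seminorms.
Context {K : realType} {A : comPzRingType}.
Implicit Types nu : A -> K.

Definition nonarch_seminorm nu :=
  [/\ nu 0 = 0, forall x, 0 <= nu x &
      forall x y, nu (x - y) <= Num.max (nu x) (nu y)].

Definition power_multiplicative_seminorm nu :=
  [/\ nonarch_seminorm nu, nu 1 <= 1, forall x y, nu (x * y) <= nu x * nu y &
      forall x, nu (x ^+ 2) = nu x ^+ 2].

(* nu 1 <= 1 only, so the zero seminorm is allowed. *)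
Definition multiplicative_seminorm nu :=
  [/\ nonarch_seminorm nu, nu 1 <= 1 & forall x y, nu (x * y) = nu x * nu y].

Definition power_multiplicative_norm nu :=
  power_multiplicative_seminorm nu /\ forall x, nu x = 0 -> x = 0.

(* As every element takes values in [0, nu a] at a, the topology induced by the
   product of the segments [0, nu a] is the one induced by {ptws A -> K}. *)
Definition berkovich nu : set {ptws A -> K} :=
  [set beta | multiplicative_seminorm beta /\ forall a, beta a <= nu a].

End Seminorms.

Section WittSeminorms.
Context {K : realType} {p : nat} {pr : prime p} {R : comPzRingType}.
Implicit Types (gamma : R -> K) (x varpi : witt pr R).

(* The supremum is a maximum when gamma <= 1: the terms tend to 0. *)
Definition witt_lambda gamma x : K :=
  sup [set p%:R ^- i * gamma (tcoef x i) | i in [set: nat]].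

(* The exponent convention is 0 ^+ 0 = 1, which matters at t = 0. *)
Definition witt_H gamma varpi (t : K) x : K :=
  inf [set r | exists (a : nat -> witt pr R) (n : nat),
    [/\ forall i, (n <= i)%N -> a i = 0,
        \sum_(i < n) a i * varpi ^+ i = x &
        r = \big[Num.max/0]_(i < n) ((t / p%:R) ^+ i * witt_lambda gamma (a i))]].

End WittSeminorms.

(* Main.v *)
Require Import Defs.
From mathcomp Require Import all_boot all_order all_algebra.
From mathcomp Require Import finmap.
From mathcomp Require Import monalg.
From mathcomp Require Import all_classical all_reals all_analysis.
From mathcomp Require Import ring lra.
Import Order.TTheory GRing.Theory Num.Theory.
Import numFieldTopology.Exports numFieldNormedType.Exports.
Set Implicit Arguments.
Unset Strict Implicit.
Unset Printing Implicit Defensive.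
Local Open Scope classical_set_scope.
Local Open Scope ring_scope.

(* For 1/p <= rho <= 1 let |x|_rho = sup_i rho^i gamma(x_i), a submultiplicative
   nonarchimedean seminorm on W(R); lambda(gamma) is the case rho = 1/p.  As varpi_1
   is a unit, varpi = [varpi_0] + p u with u a unit of W(R), so modulo varpi one may
   replace p by - [varpi_0] u^-1, whose Gauss norm is at most 1/p.  Iterating this n
   times turns any element into one whose leading digit y_0 satisfies
   |y|_1 <= max(gamma(y_0), p^-n), by a recipe independent of gamma.  Repeating on
   the cofactor of varpi gives x = sum_(k < n) y_k varpi^k + z varpi^n with every
   y_k of this kind.  Since |varpi x|_rho = rho |x|_rho for rho > 1/p, whereas
   |y|_rho does not depend on rho when the leading digit of y dominates, no
   presentation of x can do better than this one, whence
     max(H(gamma, varpi, t)(x), p^-n) = max(max_k (t/p)^k gamma(y_(k,0)), p^-n).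
   This gives multiplicativity by looking at the first maximal terms of two such
   presentations, and continuity as a uniform limit of continuous functions. *)

(** * Weighted homogeneity of the universal Witt polynomials *)

Section Isobaric.
Context {I : choiceType} (wt : I -> nat).

Definition cweight (m : {cmonom I}) : nat :=
  (\sum_(i <- finsupp m) m i * wt i)%N.

Definition isobaric (d : nat) (f : zpoly I) :=
  forall m, m \in msupp f -> cweight m = d.

Lemma cweightw (d : {fset I}) (m : {cmonom I}) : (finsupp m `<=` d)%fset ->
  cweight m = (\sum_(i <- d) m i * wt i)%N.
Proof.
move=> le; rewrite /cweight; apply: big_fset_incl => // i _.
by rewrite -cmE_eq0 => /eqP ->.
Qed.

Lemma cweightM (m1 m2 : {cmonom I}) :
  cweight (mmul m1 m2) = (cweight m1 + cweight m2)%N.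
Proof.
rewrite (@cweightw (finsupp m1 `|` finsupp m2)%fset) ?mdomD//.
rewrite (@cweightw (finsupp m1 `|` finsupp m2)%fset m1) ?fsubsetUl//.
rewrite (@cweightw (finsupp m1 `|` finsupp m2)%fset m2) ?fsubsetUr//.
by rewrite -big_split; apply: eq_bigr => i _; rewrite cmM mulnDl.
Qed.

Lemma isobaricU (c : int) m : isobaric (cweight m) << c *g m >>.
Proof. by move=> k /(fsubsetP msuppU_le); rewrite in_fset1 => /eqP ->. Qed.

Lemma isobaric0 d : isobaric d 0.
Proof. by move=> m; rewrite msupp0. Qed.

Lemma isobaricD d f g : isobaric d f -> isobaric d g -> isobaric d (f + g).
Proof.
move=> hf hg m /(fsubsetP (msuppD_le f g)); rewrite in_fsetU => /orP[].
  exact: hf.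
exact: hg.
Qed.

Lemma isobaricN d f : isobaric d f -> isobaric d (- f).
Proof. by move=> hf m; rewrite msuppN; exact: hf. Qed.

Lemma isobaric_sum d (J : eqType) (r : seq J) (F : J -> zpoly I) :
  (forall j, j \in r -> isobaric d (F j)) -> isobaric d (\sum_(j <- r) F j).
Proof.
move=> h; rewrite big_seq; apply: big_ind => //; first exact: isobaric0.
by move=> f g; exact: isobaricD.
Qed.

Lemma isobaricMn d f n : isobaric d f -> isobaric d (f *+ n).
Proof.
move=> h; elim: n => [|n IH]; first by rewrite mulr0n; exact: isobaric0.
by rewrite mulrS; exact: isobaricD.
Qed.

Lemma isobaricM d e f g : isobaric d f -> isobaric e g -> isobaric (d + e) (f * g).
Proof.
move=> hf hg; rewrite malgME; apply: isobaric_sum => m mf.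
apply: isobaric_sum => k kg; rewrite -(hf _ mf) -(hg _ kg) -cweightM.
exact: isobaricU.
Qed.

Lemma isobaric1 : isobaric 0 1.
Proof.
suff -> : 0%N = cweight mone by exact: isobaricU.
by rewrite /cweight mdom1 big_seq_fset0.
Qed.

Lemma isobaricX d f n : isobaric d f -> isobaric (d * n) (f ^+ n).
Proof.
move=> h; elim: n => [|n IH]; first by rewrite expr0 muln0; exact: isobaric1.
by rewrite exprS mulnS; exact: isobaricM.
Qed.

Lemma isobaric_zvar i : isobaric (wt i) (zvar i).
Proof.
have -> : wt i = cweight (ucm i).
  by rewrite /cweight mdomU big_seq_fset1 cmUU mul1n.
by rewrite zvar.unlock; exact: isobaricU.
Qed.

(** [zdivn] only alters coefficients of monomials already present; hence the recursion defining
    [unghost] preserves weights. *)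
Lemma isobaric_zdivn d n f : isobaric d f -> isobaric d (zdivn n f).
Proof.
move=> h; apply: isobaric_sum => m mf; rewrite -(h _ mf); exact: isobaricU.
Qed.

Lemma isobaric_ghost_low p n (x : nat -> zpoly I) :
  (forall i, (i < n)%N -> isobaric (p ^ i) (x i)) ->
  isobaric (p ^ n) (ghost_low p n x).
Proof.
move=> h; rewrite ghost_low.unlock; apply: isobaric_sum => i _; apply: isobaricMn.
have -> : (p ^ n = p ^ i * p ^ (n - i))%N by rewrite -expnD subnKC// ltnW.
by apply: isobaricX; exact: h.
Qed.

Lemma isobaric_ghost p n (x : nat -> zpoly I) :
  (forall i, isobaric (p ^ i) (x i)) -> isobaric (p ^ n) (ghost p n x).
Proof.
move=> h; rewrite ghostE; apply: isobaricD; last exact: isobaricMn.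
by apply: isobaric_ghost_low.
Qed.

Lemma isobaric_unghost p (g : nat -> zpoly I) :
  (forall n, isobaric (p ^ n) (g n)) -> forall n, isobaric (p ^ n) (unghost p g n).
Proof.
move=> h; elim/ltn_ind => n IH; rewrite unghostE.
apply: isobaric_zdivn; apply: isobaricD => //; apply: isobaricN.
exact: isobaric_ghost_low.
Qed.
End Isobaric.

(* The n-th coordinate of a Witt vector has weight p^n. *)
Definition witt_weight (p : nat) (i : bool * nat) := (p ^ i.2)%N.

Lemma isobaric_witt_add_poly p n :
  isobaric (witt_weight p) (p ^ n) (witt_add_poly p n).
Proof.
apply: isobaric_unghost => m.
by apply: isobaricD; apply: isobaric_ghost => i; exact: isobaric_zvar.
Qed.

Lemma isobaric_witt_opp_poly p n :
  isobaric (witt_weight p) (p ^ n) (witt_opp_poly p n).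
Proof.
apply: isobaric_unghost => m.
by apply: isobaricN; apply: isobaric_ghost => i; exact: isobaric_zvar.
Qed.

(** * Teichmueller digits, congruences modulo powers of p, and units of W(R) *)

Section WittDigits.
Context (p : nat) (pr : prime p) (R : comPzRingType).
Context (charR : p%:R = 0 :> R) (perfR : perfect p R).
Local Notation W := (witt pr R).
Implicit Types x y : W.

Lemma tcoef0D x y : tcoef (x + y) 0 = tcoef x 0 + tcoef y 0.
Proof. by rewrite !(tcoef0 perfR) wcoord0D. Qed.

Lemma tcoef0M x y : tcoef (x * y) 0 = tcoef x 0 * tcoef y 0.
Proof.
rewrite !(tcoef0 perfR); have := ghostM 0 x y.
by rewrite ghost.unlock !big_ord1 expn0 !expr1.
Qed.

(** Multiplying the expansion of x termwise by [a] gives another Teichmueller expansion, and such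
    expansions are unique. *)
Lemma tcoef_teichM (a : R) x i : tcoef (teich pr a * x) i = a * tcoef x i.
Proof.
apply/esym; apply: (tcoef_unique charR perfR (c := fun i => a * tcoef x i)) => n.
have [y xE] := tcoef_expansion charR perfR x n; exists (teich pr a * y).
rewrite {1}xE mulrDr mulr_sumr -mulrnAr; congr (_ + _).
by apply: eq_bigr => j _; rewrite teichM mulrnAr.
Qed.

Lemma tcoef_mulp x i : tcoef (x *+ p) i.+1 = tcoef x i.
Proof.
rewrite -(tcoef_wtail perfR); congr tcoef; apply: (mulp_inj charR perfR).
apply/esym; rewrite {1}(teich_wtail charR perfR (x *+ p)).
rewrite (wcoord_mulp charR) /=.
suff -> : teich pr (0 : R) = 0 by rewrite add0r.
by apply: witt_eq; apply/funext => -[|n].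
Qed.

Lemma tcoef_mulp0 x : tcoef (x *+ p) 0 = 0.
Proof. by rewrite (tcoef0 perfR) (wcoord_mulp charR). Qed.

Lemma tcoef_mulpX x n i :
  tcoef (x *+ p ^ n) i = if (i < n)%N then 0 else tcoef x (i - n).
Proof.
elim: n i => [|n IH] i; first by rewrite expn0 mulr1n subn0.
rewrite expnSr mulrnA; case: i => [|i]; first exact: tcoef_mulp0.
by rewrite tcoef_mulp IH ltnS subSS.
Qed.

Lemma witt_digitsP x y : (forall i, tcoef x i = tcoef y i) -> x = y.
Proof.
move=> xy; apply: witt_eq; apply/funext => i.
by rewrite -(prootK perfR i (wcoord x i)) -(prootK perfR i (wcoord y i)) -!/(tcoef _ _) xy.
Qed.

(** Congruence modulo p^n W(R); [wcong_tcoef] and [tcoef_wcong] identify it with agreement of the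
    first n digits. *)
Definition wcong n x y := exists z, x = y + z *+ p ^ n.

Lemma wcong_refl n x : wcong n x x.
Proof. by exists 0; rewrite mul0rn addr0. Qed.

Lemma wcong_trans n x y z : wcong n x y -> wcong n y z -> wcong n x z.
Proof. by move=> [u ->] [v ->]; exists (v + u); rewrite mulrnDl addrA. Qed.

Lemma wcongM n a x y : wcong n x y -> wcong n (a * x) (a * y).
Proof. by move=> [z ->]; exists (a * z); rewrite mulrDr mulrnAr. Qed.

Lemma wcongW m n x y : (m <= n)%N -> wcong n x y -> wcong m x y.
Proof.
move=> mn [z ->]; exists (z *+ p ^ (n - m)).
by rewrite -mulrnA -expnD subnK.
Qed.

(** Stripping off the common leading digit and cancelling one factor p leaves a congruence between
    the tails, to which induction applies. *)
Lemma wcong_tcoef n x y : wcong n x y ->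
  forall i, (i < n)%N -> tcoef x i = tcoef y i.
Proof.
elim: n x y => // n IH x y [z xy].
have xy0 : tcoef x 0 = tcoef y 0.
  by rewrite xy tcoef0D tcoef_mulpX /= addr0.
have xyt : wcong n (wtail x) (wtail y).
  exists z; apply: (mulp_inj charR perfR); apply: (addrI (teich pr (wcoord y 0%N))).
  rewrite mulrnDl addrA -(teich_wtail charR perfR) -mulrnA -expnSr -xy.
  by rewrite -!(tcoef0 perfR) -xy0 (tcoef0 perfR) -(teich_wtail charR perfR).
by case=> [|i] // i_n; rewrite -!(tcoef_wtail perfR); exact: IH xyt _ _.
Qed.

Lemma tcoef_wcong n x y : (forall i, (i < n)%N -> tcoef x i = tcoef y i) ->
  wcong n x y.
Proof.
move=> xy; have [u xu] := tcoef_expansion charR perfR x n.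
have [v yv] := tcoef_expansion charR perfR y n.
exists (u - v); rewrite {1}xu {1}yv mulrnBl -addrA [_ + (_ - _)]addrC subrK.
by congr (_ + _); apply: eq_bigr => i _; rewrite xy.
Qed.

Lemma wcong_eq x y : (forall n, wcong n x y) -> x = y.
Proof.
by move=> xy; apply: witt_digitsP => i; exact: wcong_tcoef (xy i.+1) _ _.
Qed.

Lemma witt_complete (s : nat -> W) : (forall n, wcong n (s n.+1) (s n)) ->
  exists x, forall n, wcong n x (s n).
Proof.
move=> sS; have sD n k : wcong n (s (n + k)%N) (s n).
  elim: k => [|k IH]; first by rewrite addn0; exact: wcong_refl.
  apply: wcong_trans IH; rewrite addnS.
  by apply: wcongW (sS _); rewrite leq_addr.
(* The i-th digit is stable from [s i.+1] on; the power p^i turns a digit into a Witt coordinate. *)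
pose x : W := Witt (fun i => tcoef (s i.+1) i ^+ (p ^ i)).
have xE i : tcoef x i = tcoef (s i.+1) i by exact: (exprK_proot perfR).
exists x => n; apply: tcoef_wcong => i i_n; rewrite xE -(subnKC i_n).
by apply/esym; exact: wcong_tcoef (sD _ _) _ _.
Qed.

(** The inverse is the p-adic limit of the partial sums of the geometric series in [z *+ p]. *)
Lemma witt_geometric z : exists x, x * (1 - z *+ p) = 1.
Proof.
pose s n := \sum_(i < n) (z *+ p) ^+ i.
have powE n : (z *+ p) ^+ n = z ^+ n *+ p ^ n.
  by rewrite exprMn_n.
have sE n : s n * (1 - z *+ p) = 1 - z ^+ n *+ p ^ n.
  rewrite -powE /s; elim: n => [|n IH].
    by rewrite big_ord0 expr0 subrr mul0r.
  by rewrite big_ord_recr /= mulrDl IH exprSr; ring.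
have [x xs] : exists x, forall n, wcong n x (s n).
  apply: witt_complete => n; exists (z ^+ n).
  by rewrite /s big_ord_recr /= powE.
exists x; apply: wcong_eq => n; have [y ->] := xs n.
by exists (- z ^+ n + y * (1 - z *+ p)); rewrite mulrDl sE mulrnDl mulNrn mulrnAl addrA.
Qed.

(** Scaling by [a] makes the leading digit 1, and an element 1 - pz is inverted by the geometric
    series. *)
Lemma witt_unit x (a : R) : a * tcoef x 0 = 1 -> exists y, y * x = 1.
Proof.
move=> ax; have [z zE] : exists z, teich pr a * x = 1 - z *+ p.
  exists (- wtail (teich pr a * x)).
  rewrite mulNrn opprK {1}(teich_wtail charR perfR (teich pr a * x)).
  by rewrite -(tcoef0 perfR) tcoef_teichM ax.
have [y yz] := witt_geometric z.
by exists (y * teich pr a); rewrite -mulrA zE.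
Qed.
End WittDigits.

(** * Ultrametric inequalities for a general seminorm *)

Section Nonarchimedean.
Context {K : realType} {A : comPzRingType} {nu : A -> K}.
Context (nuP : nonarch_seminorm nu).

Lemma nonarch0 : nu 0 = 0. Proof. by case: nuP. Qed.

Lemma nonarch_ge0 x : 0 <= nu x. Proof. by case: nuP. Qed.

Lemma nonarchN x : nu (- x) = nu x.
Proof.
have le y : nu (- y) <= nu y.
  case: nuP => nu0 nu_ge0 /(_ 0 y); rewrite sub0r nu0.
  by move/le_trans; apply; rewrite ge_max nu_ge0 lexx.
by apply/eqP; rewrite eq_le le /=; have := le (- x); rewrite opprK.
Qed.

Lemma nonarchD x y : nu (x + y) <= Num.max (nu x) (nu y).
Proof. by case: nuP => _ _ /(_ x (- y)); rewrite opprK nonarchN. Qed.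

Lemma nonarchD_le x y B : nu x <= B -> nu y <= B -> nu (x + y) <= B.
Proof. by move=> hx hy; apply: le_trans (nonarchD x y) _; rewrite ge_max hx. Qed.

Lemma nonarchD_lt x y B : nu x < B -> nu y < B -> nu (x + y) < B.
Proof. by move=> hx hy; apply: le_lt_trans (nonarchD x y) _; rewrite gt_max hx. Qed.

Lemma nonarch_sum (J : eqType) (r : seq J) (P : pred J) (F : J -> A) B :
  0 <= B -> (forall j, j \in r -> P j -> nu (F j) <= B) ->
  nu (\sum_(j <- r | P j) F j) <= B.
Proof.
move=> B0 h; rewrite big_seq_cond; apply: (big_ind (fun a => nu a <= B)) => //.
- by rewrite nonarch0.
- by move=> a b; exact: nonarchD_le.
- by move=> j /andP[]; exact: h.
Qed.

Lemma nonarch_sum_lt (J : Type) (r : seq J) (P : pred J) (F : J -> A) B :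
  0 < B -> (forall j, P j -> nu (F j) < B) ->
  nu (\sum_(j <- r | P j) F j) < B.
Proof.
move=> B0 h; apply: (big_ind (fun a => nu a < B)) => //.
- by rewrite nonarch0.
- by move=> a b; exact: nonarchD_lt.
Qed.

(** If x + y were smaller than x, then x = (x + y) - y would be a difference of two elements smaller
    than x. *)
Lemma nonarch_dominant x y : nu y < nu x -> nu (x + y) = nu x.
Proof.
move=> yx; apply/eqP; rewrite eq_le nonarchD_le ?(ltW yx)//= leNgt.
apply/negP => h; suff : nu (x + y + - y) < nu x by rewrite addrK ltxx.
by apply: nonarchD_lt; rewrite ?nonarchN.
Qed.

Lemma nonarchMz x (c : int) : nu (x *~ c) <= nu x.
Proof.
have n_le n : nu (x *+ n) <= nu x.
  elim: n => [|n IH]; first by rewrite mulr0n nonarch0 nonarch_ge0.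
  by rewrite mulrS; exact: nonarchD_le.
by case: c => n; rewrite ?NegzE ?mulrNz ?nonarchN -!pmulrn.
Qed.

Lemma nonarchZ (a : K) : 0 <= a -> nonarch_seminorm (fun x => a * nu x).
Proof.
move=> a0; split=> [|x|x y].
- by rewrite nonarch0 mulr0.
- by rewrite mulr_ge0// nonarch_ge0.
by rewrite -maxr_pMr// ler_wpM2l//; case: nuP.
Qed.
End Nonarchimedean.

(** * The Gauss norms of radius rho on W(R) *)

Section WeightedGaussNorm.
Context {K : realType} {p : nat} {pr : prime p} {R : comPzRingType}.
Context (charR : p%:R = 0 :> R) (perfR : perfect p R).
Context (gamma : R -> K) (gammaP : multiplicative_seminorm gamma).
Context (gamma_le1 : forall r, gamma r <= 1).
Local Notation W := (witt pr R).
Implicit Types (x y z : W) (rho : K).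

Let gammaN : nonarch_seminorm gamma. Proof. by case: gammaP. Qed.
Let gamma_ge0 := nonarch_ge0 gammaN.
Let gammaM a b : gamma (a * b) = gamma a * gamma b.
Proof. by case: gammaP. Qed.

(** At exponent 0 only an inequality is available, as [gamma 1] may be 0; hence the positive
    exponent in [seminormX]. *)
Lemma seminormX_le a n : gamma (a ^+ n) <= gamma a ^+ n.
Proof.
elim: n => [|n IH]; first by rewrite !expr0; case: gammaP.
by rewrite !exprS gammaM ler_wpM2l.
Qed.

Lemma seminormX a n : (0 < n)%N -> gamma (a ^+ n) = gamma a ^+ n.
Proof.
case: n => // n _; elim: n => [|n IH]; first by rewrite !expr1.
by rewrite exprS gammaM IH -exprS.
Qed.

(** Each variable contributes at most r to the power of its weight, so a monomial of weight p^n is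
    at most r^(p^n); integer coefficients do not increase the value. *)
Lemma zeval_isobaric_le n (f : zpoly (bool * nat)%type) v (r : K) : 0 <= r ->
  isobaric (witt_weight p) (p ^ n) f ->
  (forall b i, (i <= n)%N -> gamma (v (b, i)) <= r ^+ (p ^ i)) ->
  gamma (zeval v f) <= r ^+ (p ^ n).
Proof.
move=> r0 fP vr; rewrite zeval.unlock.
apply: (nonarch_sum gammaN) => [|m mf _]; first exact: exprn_ge0.
apply: le_trans (nonarchMz gammaN _ _) _; rewrite -(fP m mf) /meval /cweight.
rewrite expr_sum big_seq [leRHS]big_seq.
suff : gamma (\prod_(i <- finsupp m | i \in finsupp m) v i ^+ m i) <=
     \prod_(i <- finsupp m | i \in finsupp m) r ^+ (m i * witt_weight p i) /\
     0 <= \prod_(i <- finsupp m | i \in finsupp m) r ^+ (m i * witt_weight p i) by case.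
apply: (big_ind2 (fun a b => gamma a <= b /\ 0 <= b)).
- by split=> //; case: gammaP.
- move=> a b c d [ab b0] [cd d0]; rewrite gammaM.
  by split; [exact: ler_pM | exact: mulr_ge0].
- move=> [b i] im; split; last exact: exprn_ge0.
  apply: le_trans (seminormX_le _ _) _; rewrite mulnC exprM lerXn2r ?nnegrE ?exprn_ge0//.
  (* A variable occurring in a monomial of weight p^n has weight at most p^n, so its index is at
     most n. *)
  apply: vr; rewrite -(leq_exp2l _ _ (prime_gt1 pr)) -(fP m mf) /cweight.
  rewrite (big_fsetD1 _ im) /=; apply: leq_trans (leq_addr _ _).
  by rewrite leq_pmull// lt0n cmE_neq0.
Qed.

(** The norm |x|_rho; for 0 < rho <= 1 and gamma <= 1 its terms are at most 1, so the supremum is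
    genuine. *)
Definition gauss rho x : K :=
  sup [set rho ^+ i * gamma (tcoef x i) | i in [set: nat]].

Section FixedRadius.
Context (rho : K) (rho_gt0 : 0 < rho) (rho_le1 : rho <= 1).
Local Notation gauss := (gauss rho).

Let rhoX_ge0 i : 0 <= rho ^+ i. Proof. exact/exprn_ge0/ltW. Qed.

Let term_le1 x i : rho ^+ i * gamma (tcoef x i) <= 1.
Proof. by rewrite mulr_ile1// exprn_ile1// ltW. Qed.

Lemma gauss_ub x i : rho ^+ i * gamma (tcoef x i) <= gauss x.
Proof.
apply: ub_le_sup; last by exists i.
by exists 1 => _ [j _ <-]; exact: term_le1.
Qed.

Lemma gauss_le x B : (forall i, rho ^+ i * gamma (tcoef x i) <= B) -> gauss x <= B.
Proof.
move=> h; apply: ge_sup; first by eexists; exists 0%N.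
by move=> _ [i _ <-].
Qed.

Lemma gauss_tcoef0 x : gamma (tcoef x 0) <= gauss x.
Proof. by have := gauss_ub x 0; rewrite expr0 mul1r. Qed.

Lemma gauss_ge0 x : 0 <= gauss x.
Proof. exact: le_trans (gamma_ge0 _) (gauss_tcoef0 x). Qed.

Lemma gauss_le1 x : gauss x <= 1.
Proof. by apply: gauss_le => i; exact: term_le1. Qed.

Let tcoefX x i : gamma (tcoef x i) ^+ (p ^ i) = gamma (wcoord x i).
Proof. by rewrite -seminormX ?expn_gt0 ?prime_gt0// prootK. Qed.

(** With B the right-hand side, all digits of x and y of index i <= n are at most r = rho^-n B,
    because rho <= 1. The i-th coordinates are then at most r^(p^i), so homogeneity bounds the n-th
    coordinate of z by r^(p^n), and a root is taken. *)
Let gauss_isobaric x y z n (f : zpoly (bool * nat)%type) :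
  isobaric (witt_weight p) (p ^ n) f ->
  wcoord z n = zeval (wpair (wcoord x) (wcoord y)) f ->
  rho ^+ n * gamma (tcoef z n) <= Num.max (gauss x) (gauss y).
Proof.
move=> fP zE; set B := Num.max _ _.
have B0 : 0 <= B by rewrite le_max gauss_ge0.
have rB i u : (i <= n)%N -> gauss u <= B -> gamma (tcoef u i) <= rho ^- n * B.
  move=> i_n uB; rewrite mulrC ler_pdivlMr ?exprn_gt0// mulrC.
  apply: le_trans uB; apply: le_trans (gauss_ub u i).
  by rewrite ler_wpM2r// ler_wiXn2l// ltW.
rewrite mulrC -ler_pdivlMr ?exprn_gt0// mulrC.
rewrite -(@ler_pXn2r _ (p ^ n)) ?expn_gt0 ?prime_gt0// ?nnegrE//; last first.
  by rewrite mulr_ge0// invr_ge0.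
rewrite tcoefX zE; apply: zeval_isobaric_le => //; first by rewrite mulr_ge0// invr_ge0.
move=> b i i_n; have -> : wpair (wcoord x) (wcoord y) (b, i) = wcoord (if b then y else x) i.
  by case: b.
rewrite -tcoefX lerXn2r ?nnegrE// ?mulr_ge0 ?invr_ge0//; apply: rB => //.
by case: b; rewrite le_max lexx ?orbT.
Qed.

Lemma gauss_nonarch : nonarch_seminorm gauss.
Proof.
have gaussD x y : gauss (x + y) <= Num.max (gauss x) (gauss y).
  apply: gauss_le => n.
  exact: (@gauss_isobaric x y (x + y) n _ (@isobaric_witt_add_poly p n)).
split=> [||x y].
- apply/eqP; rewrite eq_le gauss_ge0 andbT; apply: gauss_le => i.
  suff -> : tcoef (0 : W) i = 0 by rewrite (nonarch0 gammaN) mulr0.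
  apply: (expr_pow_inj perfR (n := i)); rewrite (prootK perfR) expr0n expn_eq0.
  by rewrite (gtn_eqF (prime_gt0 pr)).
- exact: gauss_ge0.
- apply: le_trans (gaussD _ _) _.
  rewrite ge_max le_max lexx /= le_max; apply/orP; right.
  (* [wopp] evaluates its polynomial at a pair of equal sequences, so the bound is a maximum of two
     equal norms. *)
  apply: gauss_le => n; rewrite -[leRHS]maxxx.
  exact: (@gauss_isobaric y y (- y) n _ (@isobaric_witt_opp_poly p n)).
Qed.

Lemma gauss_teichM a x : gauss (teich pr a * x) <= gamma a * gauss x.
Proof.
apply: gauss_le => i; rewrite (tcoef_teichM charR perfR) gammaM mulrCA.
by rewrite ler_wpM2l// gauss_ub.
Qed.

Lemma gauss_mulp x : gauss (x *+ p) = rho * gauss x.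
Proof.
apply/eqP; rewrite eq_le; apply/andP; split.
  apply: gauss_le => -[|i].
    by rewrite (tcoef_mulp0 charR perfR) (nonarch0 gammaN) mulr0 mulr_ge0 ?gauss_ge0// ltW.
  rewrite (tcoef_mulp charR perfR) exprS -mulrA ler_wpM2l ?gauss_ub//.
  exact: ltW.
rewrite mulrC -ler_pdivlMr//; apply: gauss_le => i.
by rewrite ler_pdivlMr// mulrAC -exprSr -(tcoef_mulp charR perfR) gauss_ub.
Qed.

Lemma gauss_mulpX x n : gauss (x *+ p ^ n) = rho ^+ n * gauss x.
Proof.
elim: n => [|n IH]; first by rewrite expn0 mulr1n mul1r.
by rewrite expnSr mulrnA gauss_mulp IH mulrA -exprS.
Qed.

Lemma gauss_teich a : gauss (teich pr a) <= gamma a.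
Proof.
rewrite -[teich pr a]mulr1; apply: le_trans (gauss_teichM _ _) _.
by rewrite ler_piMr// gauss_le1.
Qed.

(** Digit n of the product depends only on x and y modulo p^(n+1), so both may be replaced by finite
    sums of terms p^i [x_i], whose products are again of this form. *)
Lemma gaussM x y : gauss (x * y) <= gauss x * gauss y.
Proof.
apply: gauss_le => n.
pose s z := \sum_(i < n.+1) teich pr (tcoef z i) *+ p ^ i.
have sP z : wcong n.+1 z (s z) by exact: tcoef_expansion.
have -> : tcoef (x * y) n = tcoef (s x * s y) n.
  apply: (wcong_tcoef charR perfR (n := n.+1)) => //.
  apply: wcong_trans (wcongM _ (sP y)) _.
  by rewrite ![_ * s y]mulrC; exact: wcongM.
apply: le_trans (gauss_ub _ _) _; rewrite mulr_suml.
apply: (nonarch_sum gauss_nonarch) => [|i _ _]; first by rewrite mulr_ge0 ?gauss_ge0.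
rewrite mulr_sumr; apply: (nonarch_sum gauss_nonarch) => [|j _ _].
  by rewrite mulr_ge0 ?gauss_ge0.
rewrite mulrnAr mulrnAl -mulrnA -expnD -teichM gauss_mulpX.
apply: le_trans (ler_wpM2l _ (gauss_teich _)) _ => //.
by rewrite gammaM exprD mulrACA ler_pM ?mulr_ge0// gauss_ub.
Qed.
End FixedRadius.

Lemma gauss_mono rho1 rho2 x : 0 < rho1 -> rho1 <= rho2 -> rho2 <= 1 ->
  gauss rho1 x <= gauss rho2 x.
Proof.
move=> r0 r12 r1; apply: gauss_le => i.
apply: le_trans (gauss_ub (lt_le_trans r0 r12) r1 x i).
by rewrite ler_wpM2r// lerXn2r ?nnegrE// ltW// (lt_le_trans r0).
Qed.
End WeightedGaussNorm.

(** * Reduction modulo varpi and expansion in powers of varpi *)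

Section Reduction.
Context {p : nat} {pr : prime p} {R : comPzRingType}.
Context (charR : p%:R = 0 :> R) (perfR : perfect p R).
Local Notation W := (witt pr R).
Context (varpi v : W).
Context (vP : v * wtail varpi = 1).
Implicit Types x y : W.

(* As v inverts (varpi - [varpi_0]) / p, one has p = - [varpi_0] v modulo varpi. *)
Definition wred x : W :=
  teich pr (tcoef x 0) - teich pr (tcoef varpi 0) * (v * wtail x).

Lemma wredE x : x = wred x + v * wtail x * varpi.
Proof.
rewrite {1}(teich_wtail charR perfR x) {1}(teich_wtail charR perfR varpi) /wred.
rewrite -!(tcoef0 perfR) mulrDr mulrnAr -[v * _ * wtail varpi]mulrAC vP mul1r; ring.
Qed.

Lemma iter_wredE n x : exists y, x = iter n wred x + y * varpi.
Proof.
elim: n => [|n [y IH]]; first by exists 0; rewrite mul0r addr0.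
exists (v * wtail (iter n wred x) + y).
by rewrite {1}IH {1}(wredE (iter n wred x)) mulrDl addrA.
Qed.

(** The last cofactor z is itself reduced n times, which yields the next coefficient and the next
    cofactor. No seminorm enters, so one expansion serves all gamma at once; continuity rests on
    this uniformity. *)
Lemma wred_expansion n m x : exists (y : nat -> W) z,
  x = \sum_(k < m) iter n wred (y k) * varpi ^+ k + z * varpi ^+ m.
Proof.
elim: m => [|m [y [z xE]]].
  by exists (fun=> 0), x; rewrite big_ord0 add0r mulr1.
have [z' zE] := iter_wredE n z.
exists (fun k => if (k < m)%N then y k else z), z'.
rewrite big_ord_recr /= ltnn {1}xE {1}zE mulrDl exprS -mulrA addrA.
by congr (_ + _ + _); apply: eq_bigr => i _; rewrite ltn_ord.
Qed.
End Reduction.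

(** * Gauss norms of multiples of varpi and of reduced elements *)

Section PrimitiveElement.
Context {K : realType} {p : nat} {pr : prime p} {R : comPzRingType}.
Context (charR : p%:R = 0 :> R) (perfR : perfect p R).
Context (gamma : R -> K) (gammaP : multiplicative_seminorm gamma).
Context (gamma_le1 : forall r, gamma r <= 1).
Local Notation W := (witt pr R).
Context (varpi v : W).
Context (vP : v * wtail varpi = 1).
Context (varpi0 : gamma (tcoef varpi 0) <= p%:R^-1).
Implicit Types (x y z : W) (rho : K).
Local Notation q := (p%:R^-1 : K).
Local Notation gauss := (gauss gamma).
Local Notation wred := (wred varpi v).

Let gammaN : nonarch_seminorm gamma. Proof. by case: gammaP. Qed.
Let q_gt0 : 0 < q. Proof. by rewrite invr_gt0 ltr0n prime_gt0. Qed.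
Let q_lt1 : q < 1.
Proof. by rewrite invf_lt1 ?ltr0n ?prime_gt0// ltr1n prime_gt1. Qed.

Let gaussN rho : 0 < rho -> rho <= 1 -> @nonarch_seminorm K W (gauss rho).
Proof. by move=> r0 r1; exact: gauss_nonarch. Qed.

Let gauss_geM rho : 0 < rho -> rho <= 1 ->
  forall x y, gauss rho (x * y) <= gauss rho x * gauss rho y.
Proof. by move=> r0 r1 x y; exact: gaussM. Qed.

Lemma gauss_varpiM_le rho x : q <= rho -> rho <= 1 ->
  gauss rho (varpi * x) <= rho * gauss rho x.
Proof.
move=> qr r1; have r0 := lt_le_trans q_gt0 qr.
have g0 := nonarch_ge0 (gaussN r0 r1).
rewrite {1}(teich_wtail charR perfR varpi) mulrDl mulrnAl -(tcoef0 perfR).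
apply: (nonarchD_le (gaussN r0 r1)).
  apply: le_trans (gauss_teichM _ _ _ _ _ _ _ _) _ => //.
  by rewrite ler_wpM2r// (le_trans varpi0).
rewrite gauss_mulp// ler_wpM2l ?(ltW r0)//.
by apply: le_trans (gauss_geM r0 r1 _ _) _; rewrite ler_piMl// gauss_le1.
Qed.

(** Both [wtail varpi] and its inverse v have norm at most 1, so multiplication by [wtail varpi]
    preserves the norm. The summand with p thus has norm rho |x|_rho, and it dominates the one with
    [varpi_0], of norm at most q |x|_rho, unless |x|_rho = 0. *)
Lemma gauss_varpiM rho x : q < rho -> rho <= 1 ->
  gauss rho (varpi * x) = rho * gauss rho x.
Proof.
move=> qr r1; have r0 := lt_trans q_gt0 qr.
have g0 := nonarch_ge0 (gaussN r0 r1).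
have [x0|x_gt0] := leP (gauss rho x) 0.
  have {}x0 : gauss rho x = 0 by apply/eqP; rewrite eq_le x0 g0.
  rewrite x0 mulr0; apply/eqP; rewrite eq_le g0 andbT.
  by apply: le_trans (gauss_varpiM_le x (ltW qr) r1) _; rewrite x0 mulr0.
have uE : gauss rho (wtail varpi * x) = gauss rho x.
  apply/eqP; rewrite eq_le (le_trans (gauss_geM r0 r1 _ _)) ?ler_piMl ?gauss_le1//=.
  rewrite -{1}[x]mul1r -vP -mulrA.
  by apply: le_trans (gauss_geM r0 r1 _ _) _; rewrite ler_piMl ?gauss_le1.
have pE : gauss rho ((wtail varpi *+ p) * x) = rho * gauss rho x.
  by rewrite mulrnAl gauss_mulp// uE.
rewrite {1}(teich_wtail charR perfR varpi) mulrDl addrC -(tcoef0 perfR) -pE.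
apply: (nonarch_dominant (gaussN r0 r1)); rewrite pE.
apply: le_lt_trans (gauss_teichM _ _ _ _ _ _ _ _) _ => //.
by rewrite ltr_pM2r// (le_lt_trans varpi0).
Qed.

Let r1_gt0 : (0 : K) < 1 := ltr01.
Let r1_le1 := lexx (1 : K).
Let gauss1_ge0 := nonarch_ge0 (gaussN r1_gt0 r1_le1).

Lemma gauss1_wtail x : gauss 1 (wtail x) <= gauss 1 x.
Proof.
apply: gauss_le => i; rewrite (tcoef_wtail perfR).
by have := gauss_ub gammaP gamma_le1 r1_gt0 r1_le1 x i.+1; rewrite !expr1n.
Qed.

(** The error is a multiple of [varpi_0], which accounts for the factor q; neither v nor passing to
    the tail increases the norm of radius 1. *)
Lemma wred_error x : gauss 1 (wred x - teich pr (tcoef x 0)) <= q * gauss 1 x.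
Proof.
have -> : wred x - teich pr (tcoef x 0) = - (teich pr (tcoef varpi 0) * (v * wtail x)).
  by rewrite addrAC subrr add0r.
rewrite (nonarchN (gaussN r1_gt0 r1_le1)).
apply: le_trans (gauss_teichM _ _ _ _ _ _ _ _) _ => //.
apply: ler_pM => //; first exact: (nonarch_ge0 gammaN).
apply: le_trans (gauss_geM r1_gt0 r1_le1 _ _) _.
apply: le_trans (gauss1_wtail x).
by rewrite ler_piMl// gauss_le1.
Qed.

Lemma gauss1_wred x : gauss 1 (wred x) <= Num.max (gamma (tcoef x 0)) (q * gauss 1 x).
Proof.
rewrite -(subrK (teich pr (tcoef x 0)) (wred x)).
apply: (nonarchD_le (gaussN r1_gt0 r1_le1)); rewrite le_max.
  by rewrite wred_error orbT.
by rewrite gauss_teich.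
Qed.

Lemma tcoef0_wred x : q * gauss 1 x < gamma (tcoef x 0) ->
  gamma (tcoef (wred x) 0) = gamma (tcoef x 0).
Proof.
move=> h; rewrite -(subrK (teich pr (tcoef x 0)) (wred x)) (tcoef0D perfR) addrC.
rewrite [tcoef (teich _ _) 0](tcoef0 perfR).
apply: (nonarch_dominant gammaN); apply: le_lt_trans h.
apply: le_trans (wred_error x); exact: gauss_tcoef0.
Qed.

(* Either the leading digit dominates at some stage, and then it does so forever,
   or every step shrinks the Gauss norm by a factor p. *)
Lemma gauss1_iter_wred n x : gauss 1 (iter n wred x) <=
  Num.max (gamma (tcoef (iter n wred x) 0)) (q ^+ n).
Proof.
elim: n => [|n IH]; first by rewrite expr0 le_max gauss_le1// orbT.
rewrite iterS; move: (iter n wred x) IH => y IH.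
have [y0|y0] := leP (gamma (tcoef y 0)) (q * gauss 1 y); last first.
  rewrite (tcoef0_wred y0) le_max; apply/orP; left.
  by apply: le_trans (gauss1_wred y) _; rewrite ge_max lexx ltW.
have yq : gauss 1 (wred y) <= q * gauss 1 y.
  by apply: le_trans (gauss1_wred y) _; rewrite ge_max y0 lexx.
apply: (le_trans yq); rewrite le_max exprS; apply/orP; right.
rewrite ler_wpM2l ?(ltW q_gt0)//.
(* In the first alternative the norm of y is bounded by its leading digit, hence by q times itself,
   so it vanishes. *)
move: IH; rewrite le_max => /orP[|//] /le_trans/(_ y0) yy.
suff -> : gauss 1 y = 0 by exact/exprn_ge0/ltW.
apply/eqP; rewrite eq_le gauss1_ge0 andbT leNgt; apply/negP => y_gt0.
by move: yy; rewrite leNgt gtr_pMl// q_lt1.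
Qed.

(* The function rho |-> gauss rho is constant on the element at index k, whose
   leading digit dominates, but strictly increasing on multiples of varpi. *)
Lemma no_dominated_relation rho c k m (z : nat -> W) :
  q < rho -> rho <= 1 -> 0 < c -> (k < m)%N ->
  \sum_(i < m) z i * varpi ^+ i = 0 ->
  gauss rho (z k) = c -> gamma (tcoef (z k) 0) = c ->
  (forall i, (i < k)%N -> gauss rho (z i) < rho ^+ (k - i) * c) -> False.
Proof.
move=> qr r1 c0; have r0 := lt_trans q_gt0 qr.
have rN := gaussN r0 r1.
elim: k m z => [|k IH] [|m] // z km; rewrite big_ord_recl mulr1 /=.
  move=> /eqP; rewrite addr_eq0 => /eqP z0 zr zc _; move: z0.
  set S := \sum_(i < m) z i.+1 * varpi ^+ i.
  have -> : \sum_(i < m) z (bump 0 i) * varpi ^+ bump 0 i = varpi * S.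
    by rewrite mulr_sumr; apply: eq_bigr => i _; rewrite exprS mulrCA.
  move=> zS.
  have Sr s : q < s -> s <= 1 -> gauss s (z 0%N) = s * gauss s S.
    move=> qs s1; rewrite -gauss_varpiM// zS.
    exact: (nonarchN (gaussN (lt_trans q_gt0 qs) s1)).
  (* At the intermediate radius s, the leading digit of z_0 gives c <= s |S|_s, while rho |S|_s <=
     rho |S|_rho = c; this is absurd since |S|_s > 0 and s < rho. *)
  pose s := (q + rho) / 2; have qs : q < s by rewrite /s; lra.
  have sr : s < rho by rewrite /s; lra.
  have s1 : s <= 1 by lra.
  have s0 := lt_trans q_gt0 qs.
  have cs : c <= s * gauss s S.
    by rewrite -Sr// -zc gauss_tcoef0.
  have Ss : 0 < gauss s S.
    by rewrite -(pmulr_rgt0 _ s0); exact: lt_le_trans cs.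
  have := gauss_mono gammaP gamma_le1 S s0 (ltW sr) r1.
  rewrite -(ler_pM2l r0) -Sr// zr => /le_trans/(_ cs).
  by rewrite leNgt ltr_pM2r// sr.
move=> /eqP; rewrite addr_eq0 => /eqP z0 zr zc zk; move: z0.
set S := \sum_(i < m) z i.+1 * varpi ^+ i.
have -> : \sum_(i < m) z (bump 0 i) * varpi ^+ bump 0 i = varpi * S.
  by rewrite mulr_sumr; apply: eq_bigr => i _; rewrite exprS mulrCA.
move=> zS; have Sr : gauss rho S < rho ^+ k * c.
  have := zk 0%N isT; rewrite zS (nonarchN rN) gauss_varpiM// subn0 exprS -mulrA.
  by rewrite ltr_pM2l.
(* The shifted relation sums to S; subtracting S from its first coefficient restores 0, and S is too
   small to disturb the bounds or the dominant coefficient. *)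
apply: (IH m (fun i => z i.+1 - (if i is 0%N then S else 0))) => //.
- rewrite /S; case: m km {S zS Sr} => // m _.
  rewrite !big_ord_recl /= !mulr1 opprD addrA subrr add0r addrC.
  by apply/eqP; rewrite subr_eq0; apply/eqP; apply: eq_bigr => i _; rewrite subr0.
- case: k zr zc zk Sr {IH km} => [|k] zr zc zk Sr; last by rewrite subr0.
  rewrite (nonarch_dominant rN) // (nonarchN rN) zr.
  by rewrite expr0 mul1r in Sr.
- case: k zr zc zk Sr {IH km} => [|k] zr zc zk Sr; last by rewrite subr0.
  rewrite expr0 mul1r in Sr.
  rewrite -[- S]mulN1r (tcoef0D perfR) (nonarch_dominant gammaN) // zc mulN1r.
  by apply: le_lt_trans Sr; rewrite -(nonarchN rN); exact: gauss_tcoef0.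
- move=> [|i] ik.
    rewrite subn0; apply: (nonarchD_lt rN); last by rewrite (nonarchN rN).
    by have := zk 1%N ik; rewrite subSS subn0.
  by rewrite subr0; exact: zk i.+2 ik.
Qed.
End PrimitiveElement.

(** * Auxiliary facts on real numbers and indices *)

Lemma expr_lt_eps {K : realType} (s e : K) : 0 <= s -> s < 1 -> 0 < e ->
  exists n, s ^+ n < e.
Proof.
move=> s0 s1 e0; have s_lt1 : `|s| < 1 by rewrite ger0_norm.
have [n _ /(_ n (leqnn n))] := cvgr0_norm_lt _ (cvg_geometric 1 s_lt1) _ e0.
by rewrite /= mul1r ger0_norm ?exprn_ge0//; exists n.
Qed.

(** The limits in a' and b' are taken one at a time, dividing by the other factor; a = 0 is treated
    apart because it cannot be divided by. *)
Lemma ler_mul_gt {K : realType} (a b c : K) : 0 <= a -> 0 <= b ->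
  (forall a' b', a < a' -> b < b' -> c <= a' * b') -> c <= a * b.
Proof.
move=> a0 b0 h.
have h1 b' : b < b' -> c <= a * b'.
  move=> bb; have b'0 := le_lt_trans b0 bb.
  rewrite -ler_pdivrMr//; apply/unstable.ler_gtP => a' aa.
  by rewrite ler_pdivrMr//; exact: h.
have [a_gt0|] := ltP 0 a; last first.
  move=> a_le0; have aE : a = 0 by apply/eqP; rewrite eq_le a_le0.
  by have := h1 (b + 1); rewrite aE !mul0r; apply; rewrite ltrDl.
rewrite mulrC -ler_pdivrMr//; apply/unstable.ler_gtP => b' bb.
by rewrite ler_pdivrMr// mulrC h1.
Qed.

Lemma exists_first_max {K : realType} (f : nat -> K) m : (0 < m)%N ->
  exists k, [/\ (k < m)%N, forall i, (i < k)%N -> f i < f k &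
                forall i, (i < m)%N -> f i <= f k].
Proof.
case: m => // m _; elim: m => [|m [k [km lt_k le_k]]].
  by exists 0%N; split=> // -[].
have [fm|fm] := leP (f m.+1) (f k).
  exists k; split=> //; first exact: ltnW.
  by move=> i; rewrite ltnS leq_eqVlt => /orP[/eqP ->//|]; exact: le_k.
exists m.+1; split=> // i im; first exact: le_lt_trans (le_k _ im) fm.
move: im; rewrite ltnS leq_eqVlt => /orP[/eqP ->//|im].
exact: ltW (le_lt_trans (le_k _ im) fm).
Qed.

(** With [addn_eq_lt_or], this shows that in a product every term of total index at most k + l,
    other than the (k, l) one, has an index before k or before l. *)
Lemma addn_lt_or i j k l : (i + j < k + l)%N -> (i < k)%N || (j < l)%N.
Proof.
by apply: contraTT; rewrite negb_or -!leqNgt => /andP[? ?]; exact: leq_add.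
Qed.

Lemma addn_eq_lt_or i j k l : (i + j = k + l)%N -> i != k ->
  (i < k)%N || (j < l)%N.
Proof.
move=> e; case: ltngtP => //= ki _.
by rewrite -(ltn_add2l k) -e ltn_add2r.
Qed.

(** * The seminorm H: estimates and multiplicativity *)

Section WittH.
Context {K : realType} {p : nat} {pr : prime p} {R : comPzRingType}.
Context (charR : p%:R = 0 :> R) (perfR : perfect p R).
Context (gamma : R -> K) (gammaP : multiplicative_seminorm gamma).
Context (gamma_le1 : forall r, gamma r <= 1).
Local Notation W := (witt pr R).
Local Notation q := (p%:R^-1 : K).
Local Notation gauss := (gauss gamma).
Implicit Types (x y : W).

Let gammaN : nonarch_seminorm gamma. Proof. by case: gammaP. Qed.
Let q_gt0 : 0 < q. Proof. by rewrite invr_gt0 ltr0n prime_gt0. Qed.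
Let q_lt1 : q < 1.
Proof. by rewrite invf_lt1 ?ltr0n ?prime_gt0// ltr1n prime_gt1. Qed.
Let q_le1 := ltW q_lt1.
Let qN : @nonarch_seminorm K W (gauss q).
Proof. exact: gauss_nonarch. Qed.
Let r1_gt0 : (0 : K) < 1 := ltr01.
Let r1_le1 := lexx (1 : K).
Let oneN : @nonarch_seminorm K W (gauss 1).
Proof. exact: gauss_nonarch. Qed.

Lemma witt_lambdaE x : witt_lambda gamma x = gauss q x.
Proof.
rewrite /witt_lambda /gauss; congr sup; apply/eq_imagel => i _.
by rewrite exprVn.
Qed.

(** Fix s with q < s < 1 and n with s^n < B. For q < rho < s the terms of index at least n are at
    most s^n, and the others at most (rho/q)^n |x|_q, which tends to |x|_q as rho decreases to q. *)
Lemma gauss_lt_radius x B : gauss q x < B ->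
  exists rho, [/\ q < rho, rho <= 1 & gauss rho x < B].
Proof.
move=> xB; have x0 := nonarch_ge0 qN x; have B0 := le_lt_trans x0 xB.
pose s := (q + 1) / 2; have [qs s1] : q < s /\ s < 1.
  by have := q_lt1; rewrite /s => ?; split; lra.
have [n sn] := expr_lt_eps (ltW (lt_trans q_gt0 qs)) s1 B0.
have cont : (fun r : K => (r / q) ^+ n * gauss q x) r @[r --> q] --> (q / q) ^+ n * gauss q x.
  apply: cvgMr_tmp; apply: (@continuous_cvg _ K K _ _ (fun r => r / q) (fun r => r ^+ n)).
    exact: exprn_continuous.
  exact: mulrr_continuous.
have near_lt : \forall r \near q^'+, (r / q) ^+ n * gauss q x < B.
  apply: (cvgr_lt _ (cvg_at_right_filter cont)).
  by rewrite divff ?gt_eqF// expr1n mul1r.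
have [rho [[rB rs] qr]] : exists rho,
    ((rho / q) ^+ n * gauss q x < B /\ rho < s) /\ q < rho.
  have F := at_right_proper_filter q; apply: (@filter_ex _ (q^'+)).
  near=> r; split; first (split; near: r => //); last by near: r; exact: nbhs_right_gt.
  exact: nbhs_right_lt.
have r1 : rho <= 1 by exact: ltW (lt_trans rs s1).
exists rho; split=> //.
apply: (@le_lt_trans _ _ (Num.max (s ^+ n) ((rho / q) ^+ n * gauss q x))).
  apply: gauss_le => i; rewrite le_max.
  have r0 : 0 <= rho by exact: ltW (lt_trans q_gt0 qr).
  have [ni|ni] := leqP n i; apply/orP; [left|right].
    apply: le_trans (_ : rho ^+ i <= _).
      by rewrite ler_piMr// exprn_ge0.
    apply: (@le_trans _ _ (s ^+ i)).
      by rewrite lerXn2r ?nnegrE// ?ltW// (lt_trans q_gt0 qs).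
    by apply: ler_wiXn2l => //; apply: ltW => //; exact: lt_trans q_gt0 qs.
  have -> : rho ^+ i * gamma (tcoef x i) = (rho / q) ^+ i * (q ^+ i * gamma (tcoef x i)).
    by rewrite mulrA -exprMn divfK// gt_eqF.
  apply: ler_pM; rewrite ?mulr_ge0 ?exprn_ge0 ?divr_ge0 ?(ltW q_gt0) ?(nonarch_ge0 gammaN)//.
    by rewrite ler_weXn2l ?(ltnW ni)// ler_pdivlMr// mul1r ltW.
  exact: gauss_ub.
by rewrite gt_max sn.
Unshelve. all: by end_near. Qed.

Lemma gauss_lt_radii (x : nat -> W) (B : nat -> K) n :
  (forall k, (k < n)%N -> gauss q (x k) < B k) ->
  exists rho, [/\ q < rho, rho <= 1 & forall k, (k < n)%N -> gauss rho (x k) < B k].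
Proof.
elim: n => [_|n IH xB]; first by exists 1; split.
have [r [qr r1 rB]] := IH (fun k kn => xB k (ltnW kn)).
have [s [qs s1 sB]] := gauss_lt_radius (xB n (ltnSn n)).
have qm : q < Num.min r s by rewrite lt_min qr.
have m0 := lt_trans q_gt0 qm.
exists (Num.min r s); split=> // [|k]; first by rewrite ge_min r1.
rewrite ltnS leq_eqVlt => /orP[/eqP ->|kn].
  by apply: le_lt_trans sB; apply: gauss_mono => //; rewrite ge_min lexx orbT.
by apply: le_lt_trans (rB _ kn); apply: gauss_mono => //; rewrite ge_min lexx.
Qed.

Context (varpi v : W) (t : K).
Context (vP : v * wtail varpi = 1).
Context (varpi0 : gamma (tcoef varpi 0) <= q).
Context (t_ge0 : 0 <= t) (t_le1 : t <= 1).
Local Notation H := (witt_H gamma varpi t).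
Local Notation tau := (t / p%:R).

Let tau_ge0 : 0 <= tau. Proof. by rewrite mulr_ge0// ltW. Qed.
Let tau_leq : tau <= q. Proof. by rewrite ler_piMl// ltW. Qed.
Let tau_le1 : tau <= 1. Proof. exact: le_trans tau_leq q_le1. Qed.
Let tauX_ge0 k : 0 <= tau ^+ k. Proof. exact: exprn_ge0. Qed.
Let term_ge0 k x : 0 <= tau ^+ k * gauss q x.
Proof. by rewrite mulr_ge0// nonarch_ge0. Qed.

Lemma witt_H_le a n B : 0 <= B ->
  (forall i, (i < n)%N -> tau ^+ i * gauss q (a i) <= B) ->
  H (\sum_(i < n) a i * varpi ^+ i) <= B.
Proof.
move=> B0 aB; apply: (@le_trans _ _ (\big[Num.max/0]_(i < n)
    (tau ^+ i * witt_lambda gamma (a i)))); last first.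
  by apply: bigmax_le => // i _; rewrite witt_lambdaE; exact: aB.
apply: ge_inf.
  exists 0 => _ [b [m [_ _ ->]]]; exact: bigmax_ge_id.
(* The coefficients are cut off at n, since [witt_H] asks for finite support. *)
exists (fun i => if (i < n)%N then a i else 0), n; split.
- by move=> i; rewrite leqNgt => /negPf ->.
- by apply: eq_bigr => i _; rewrite ltn_ord.
- by apply: eq_bigr => i _; rewrite ltn_ord.
Qed.

(** Nonemptiness of the set of sizes, without which [inf] would be a default value. *)
Lemma witt_H_trivial x : exists r, exists (a : nat -> W) (n : nat),
    [/\ forall i, (n <= i)%N -> a i = 0,
        \sum_(i < n) a i * varpi ^+ i = x &
        r = \big[Num.max/0]_(i < n) (tau ^+ i * witt_lambda gamma (a i))].
Proof.
eexists; exists (fun i => if i is 0%N then x else 0), 1%N; split=> //.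
  by case.
by rewrite big_ord1 mulr1.
Qed.

Lemma witt_H_ge0 x : 0 <= H x.
Proof.
apply: lb_le_inf; first exact: witt_H_trivial.
by move=> _ [b [m [_ _ ->]]]; exact: bigmax_ge_id.
Qed.

(** Allowing every length m >= n lets two presentations be brought to a common length. *)
Lemma witt_H_ltP x B : H x < B -> exists (a : nat -> W) n,
  (forall m, (n <= m)%N -> \sum_(i < m) a i * varpi ^+ i = x) /\
  (forall i, tau ^+ i * gauss q (a i) < B).
Proof.
move=> xB; have B0 := le_lt_trans (witt_H_ge0 x) xB.
have [_ [a [n [a0 ax ->]]] aB] := inf_lt (witt_H_trivial x) xB.
exists a, n; split=> [m nm|i].
  rewrite -ax (@big_ord_widen _ _ _ n m (fun i => a i * varpi ^+ i))// [RHS]big_mkcond /=.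
  apply: eq_bigr => i _; case: ltnP => // ni.
  by rewrite a0// mul0r.
have [ni|i_n] := leqP n i; first by rewrite a0// (nonarch0 qN) mulr0.
move/bigmax_ltP : aB => [_ /(_ (Ordinal i_n) isT)] /=.
by rewrite witt_lambdaE.
Qed.

Lemma witt_H_term a k : H (a * varpi ^+ k) <= tau ^+ k * gauss q a.
Proof.
have -> : a * varpi ^+ k =
    \sum_(i < k.+1) (if i == k :> nat then a else 0) * varpi ^+ i.
  rewrite big_ord_recr /= eqxx big1 ?add0r// => i _.
  by rewrite (ltn_eqF (ltn_ord i)) mul0r.
apply: (@witt_H_le (fun i => if i == k then a else 0)) => // i _.
by case: eqP => [->//|_]; rewrite (nonarch0 qN) mulr0.
Qed.

Lemma witt_H_le_gauss x : H x <= gauss q x.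
Proof. by have := witt_H_term x 0; rewrite !expr0 mulr1 mul1r. Qed.

Lemma witt_H_nonarch : nonarch_seminorm H.
Proof.
split=> [||x y].
- apply/eqP; rewrite eq_le witt_H_ge0 andbT.
  by rewrite -(nonarch0 qN) witt_H_le_gauss.
- exact: witt_H_ge0.
apply/unstable.ler_gtP => B; rewrite gt_max => /andP[xB yB].
have B0 := le_lt_trans (witt_H_ge0 x) xB.
have [a [n [ax aB]]] := witt_H_ltP xB; have [b [m [bx bB]]] := witt_H_ltP yB.
rewrite -(ax (maxn n m)) ?leq_maxl// -(bx (maxn n m)) ?leq_maxr// -sumrB.
under eq_bigr do rewrite -mulrBl.
apply: (@witt_H_le (fun i => a i - b i)); first exact: ltW.
move=> i _; case: qN => _ _ /(_ (a i) (b i)) ab.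
apply: le_trans (ler_wpM2l (tauX_ge0 i) ab) _.
by rewrite maxr_pMr// ge_max !ltW.
Qed.

Lemma witt_HM_le x y : H (x * y) <= H x * H y.
Proof.
apply: ler_mul_gt; rewrite ?witt_H_ge0// => A B xA yB.
have A0 := le_lt_trans (witt_H_ge0 x) xA; have B0 := le_lt_trans (witt_H_ge0 y) yB.
have [a [n [ax aA]]] := witt_H_ltP xA; have [b [m [bx bB]]] := witt_H_ltP yB.
rewrite -(ax n)// -(bx m)// mulr_suml.
apply: (nonarch_sum witt_H_nonarch) => [|i _ _]; first by rewrite mulr_ge0// ltW.
rewrite mulr_sumr; apply: (nonarch_sum witt_H_nonarch) => [|j _ _].
  by rewrite mulr_ge0// ltW.
rewrite mulrACA -exprD; apply: le_trans (witt_H_term _ _) _.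
apply: le_trans (_ : tau ^+ (i + j) * (gauss q (a i) * gauss q (b j)) <= _).
  by rewrite ler_wpM2l// gaussM.
by rewrite exprD mulrACA ler_pM// ltW.
Qed.

(** Subtracting a cheaper presentation from this one would give a relation whose k-th coefficient
    keeps a dominant leading digit, against [no_dominated_relation]. That lemma needs a radius above
    q, which [gauss_lt_radii] provides. *)
Lemma witt_H_dominated_ge z m k c : (k < m)%N -> 0 < c ->
  gauss 1 (z k) = c -> gamma (tcoef (z k) 0) = c ->
  (forall i, (i < k)%N -> tau ^+ i * gauss 1 (z i) < tau ^+ k * c) ->
  tau ^+ k * c <= H (\sum_(i < m) z i * varpi ^+ i).
Proof.
move=> km c0 zk zk0 zi; rewrite leNgt; apply/negP => /witt_H_ltP[a [n [ax aB]]].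
(* As tau <= q, comparing weighted terms bounds g by q^(k-i) c; the factor tau^i is cancelled by
   contraposition because tau may be 0. *)
have weight i g : (i <= k)%N -> tau ^+ i * g < tau ^+ k * c -> g < q ^+ (k - i) * c.
  move=> ik; rewrite -{1}(subnKC ik) exprD -mulrA => h.
  apply: lt_le_trans (_ : tau ^+ (k - i) * c <= _).
    by rewrite ltNge; apply/negP => /(ler_wpM2l (tauX_ge0 i)); rewrite leNgt h.
  by rewrite ler_pM2r// lerXn2r ?nnegrE// ltW.
have [rho [qr r1 rB]] := gauss_lt_radii (x := a)
  (fun i ik => weight i _ ik (aB i)) (n := k.+1) .
have r0 := lt_trans q_gt0 qr.
have rN : @nonarch_seminorm K W (gauss rho) by exact: gauss_nonarch.
have qrX j : q ^+ j * c <= rho ^+ j * c by rewrite ler_pM2r// lerXn2r ?nnegrE ?ltW.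
(* The norm of radius rho lies between the value of the leading digit and the norm of radius 1, both
   equal to c. *)
have zr : gauss rho (z k) = c.
  apply/eqP; rewrite eq_le -{1}zk gauss_mono//= -zk0; exact: gauss_tcoef0.
have akc : gauss rho (a k) < c.
  by have := rB k (ltnSn k); rewrite subnn mul1r.
pose N := maxn n m; have mN : (m <= N)%N by rewrite leq_maxr.
apply: (@no_dominated_relation _ _ _ _ charR perfR _ gammaP gamma_le1 _ _ vP varpi0
  rho c k N (fun i => (if (i < m)%N then z i else 0) - a i)) => //.
- exact: leq_trans mN.
- under eq_bigr do rewrite mulrBl.
  rewrite sumrB ax ?leq_maxl// (@big_ord_widen _ _ _ m N (fun i => z i * varpi ^+ i))//.
  rewrite [X in _ - X]big_mkcond /=; apply/eqP; rewrite subr_eq0; apply/eqP.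
  by apply: eq_bigr => i _; case: ltnP; rewrite ?mul0r.
- by rewrite km (nonarch_dominant rN) zr// (nonarchN rN).
- rewrite km -mulN1r (tcoef0D perfR) (nonarch_dominant gammaN) zk0// mulN1r.
  by apply: le_lt_trans akc; rewrite -(nonarchN rN); exact: gauss_tcoef0.
move=> i ik; rewrite (ltn_trans ik km).
apply: (nonarchD_lt rN); last first.
  rewrite (nonarchN rN); apply: lt_le_trans (qrX _).
  by apply: rB; rewrite ltnS ltnW.
apply: lt_le_trans (qrX _); apply: le_lt_trans (weight _ _ (ltnW ik) (zi _ ik)).
by apply: gauss_mono.
Qed.

Lemma gauss_q_le1 x : gauss q x <= gauss 1 x.
Proof. by apply: gauss_mono. Qed.

(** At the first maximum k of the weighted norms, H bounds the norm of y_k below by more than e, so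
    the hypothesis on y_k forces its leading digit to dominate. *)
Lemma witt_H_leading (y : nat -> W) m e : 0 < e ->
  (forall k, (k < m)%N -> gauss 1 (y k) <= Num.max (gamma (tcoef (y k) 0)) e) ->
  e < H (\sum_(k < m) y k * varpi ^+ k) ->
  exists k, [/\ (k < m)%N, 0 < gauss 1 (y k),
    gamma (tcoef (y k) 0) = gauss 1 (y k),
    forall i, (i < k)%N -> tau ^+ i * gauss 1 (y i) < tau ^+ k * gauss 1 (y k) &
    forall i, (i < m)%N -> tau ^+ i * gauss 1 (y i) <= tau ^+ k * gauss 1 (y k)].
Proof.
move=> e0 ye eH.
have m0 : (0 < m)%N.
  case: m eH {ye} => // eH.
  by move: eH; rewrite big_ord0 (nonarch0 witt_H_nonarch) ltNge (ltW e0).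
have [k [km lt_k le_k]] := exists_first_max (fun k => tau ^+ k * gauss 1 (y k)) m0.
have ek : e < gauss 1 (y k).
  apply: (lt_le_trans eH); apply: witt_H_le => [|i im].
    exact: (nonarch_ge0 oneN).
  apply: (@le_trans _ _ (tau ^+ i * gauss 1 (y i))).
    by rewrite ler_wpM2l ?gauss_q_le1.
  apply: le_trans (le_k _ im) _.
  by rewrite ler_piMl ?(nonarch_ge0 oneN)// exprn_ile1.
exists k; split=> //; first exact: lt_trans ek.
apply/eqP; rewrite eq_le gauss_tcoef0//=.
by have := ye k km; rewrite le_max => /orP[//|]; rewrite leNgt ek.
Qed.

Lemma witt_H_tail z m : H (z * varpi ^+ m) <= q ^+ m.
Proof.
apply: le_trans (witt_H_term _ _) _.
apply: (@le_trans _ _ (tau ^+ m)); first by rewrite ler_piMr ?gauss_le1.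
by rewrite lerXn2r ?nnegrE// ltW.
Qed.

(** The presentation itself gives one inequality, its remainder being at most e. For the other, a
    digit term exceeding both H x and e would make the first maximal coefficient dominant, and
    [witt_H_dominated_ge] would apply to it. *)
Lemma witt_H_estimate x z (y : nat -> W) m e : 0 < e -> q ^+ m <= e ->
  x = \sum_(k < m) y k * varpi ^+ k + z * varpi ^+ m ->
  (forall k, (k < m)%N -> gauss 1 (y k) <= Num.max (gamma (tcoef (y k) 0)) e) ->
  Num.max (H x) e =
  Num.max (\big[Num.max/0]_(k < m) (tau ^+ k * gamma (tcoef (y k) 0))) e.
Proof.
move=> e0 me xE ye; set X := \sum_(k < m) _ in xE; set D := \big[Num.max/0]_(k < m) _.
have HN := witt_H_nonarch.
have ze : H (z * varpi ^+ m) <= e := le_trans (witt_H_tail z m) me.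
have HX : H X <= Num.max D e.
  apply: witt_H_le => [|k km]; first by rewrite le_max (ltW e0) orbT.
  apply: (@le_trans _ _ (tau ^+ k * gauss 1 (y k))).
    by rewrite ler_wpM2l ?gauss_q_le1.
  apply: le_trans (ler_wpM2l (tauX_ge0 k) (ye k km)) _.
  rewrite maxr_pMr// ge_max !le_max; apply/andP; split; apply/orP; [left|right].
    exact: (le_bigmax _ (fun k : 'I_m => tau ^+ k * gamma (tcoef (y k) 0)) (Ordinal km)).
  by rewrite ler_piMl ?(ltW e0)// exprn_ile1.
apply/eqP; rewrite eq_le ge_max [X in _ && X]ge_max !le_max !lexx !orbT !andbT.
rewrite -!le_max; apply/andP; split.
  by rewrite xE; apply: (nonarchD_le HN) => //; rewrite le_max ze orbT.
apply: bigmax_le => [|k _]; first by rewrite le_max (ltW e0) orbT.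
rewrite leNgt gt_max; apply/negP => /andP[Hk ek].
have XE : X = x - z * varpi ^+ m by rewrite xE addrK.
have XD : H X < tau ^+ k * gamma (tcoef (y k) 0).
  rewrite XE; apply: (nonarchD_lt HN) => //.
  by rewrite (nonarchN HN) (le_lt_trans ze).
have m0 : (0 < m)%N by exact: leq_ltn_trans (ltn_ord k).
have [l [lm lt_l le_l]] := exists_first_max (fun k => tau ^+ k * gauss 1 (y k)) m0.
have kl : tau ^+ k * gamma (tcoef (y k) 0) <= tau ^+ l * gauss 1 (y l).
  apply: le_trans (le_l _ (ltn_ord k)).
  by rewrite ler_wpM2l// gauss_tcoef0.
have el : e < gauss 1 (y l).
  apply: lt_le_trans ek _; apply: (le_trans kl).
  by rewrite ler_piMl ?(nonarch_ge0 oneN)// exprn_ile1.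
have yl : gamma (tcoef (y l) 0) = gauss 1 (y l).
  apply/eqP; rewrite eq_le gauss_tcoef0//=.
  by have := ye l lm; rewrite le_max => /orP[//|]; rewrite leNgt el.
have := witt_H_dominated_ge lm (lt_trans e0 el) erefl yl lt_l.
by move/(le_trans kl); rewrite leNgt XD.
Qed.

(** The argument of Gauss's lemma: if k and l are the first maxima for X and Y, the coefficient of
    varpi^(k+l) in X Y is a_k b_l plus strictly smaller terms, so its leading digit dominates. *)
Lemma witt_HM_dominated (a b : nat -> W) m e : 0 < e ->
  (forall k, (k < m)%N -> gauss 1 (a k) <= Num.max (gamma (tcoef (a k) 0)) e) ->
  (forall k, (k < m)%N -> gauss 1 (b k) <= Num.max (gamma (tcoef (b k) 0)) e) ->
  let X := \sum_(k < m) a k * varpi ^+ k in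
  let Y := \sum_(k < m) b k * varpi ^+ k in
  e < H X -> e < H Y -> H X * H Y <= H (X * Y).
Proof.
move=> e0 ae be X Y eX eY.
have [k [km ck ak lt_k le_k]] := witt_H_leading e0 ae eX.
have [l [lm cl bl lt_l le_l]] := witt_H_leading e0 be eY.
set c := gauss 1 (a k) in ck ak lt_k le_k; set d := gauss 1 (b l) in cl bl lt_l le_l.
have HX : H X <= tau ^+ k * c.
  apply: witt_H_le => [|i im]; first by rewrite mulr_ge0// ltW.
  by apply: le_trans (le_k i im); rewrite ler_wpM2l ?gauss_q_le1.
have HY : H Y <= tau ^+ l * d.
  apply: witt_H_le => [|i im]; first by rewrite mulr_ge0// ltW.
  by apply: le_trans (le_l i im); rewrite ler_wpM2l ?gauss_q_le1.
have F0 : 0 < tau ^+ k * c by exact: lt_le_trans (lt_trans e0 eX) HX.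
have G0 : 0 < tau ^+ l * d by exact: lt_le_trans (lt_trans e0 eY) HY.
have cd0 : 0 < tau ^+ (k + l) * (c * d) by rewrite exprD mulrACA mulr_gt0.
pose z n := \sum_(i < m) \sum_(j < m | (i + j == n)%N) a i * b j.
have XY : X * Y = \sum_(n < m + m) z n * varpi ^+ n.
  transitivity (\sum_(n < m + m) \sum_(i < m) \sum_(j < m)
      if (i + j == n)%N then a i * b j * varpi ^+ n else 0); last first.
    apply: eq_bigr => n _; rewrite mulr_suml; apply: eq_bigr => i _.
    by rewrite mulr_suml [RHS]big_mkcond.
  rewrite exchange_big mulr_suml; apply: eq_bigr => i _ /=.
  rewrite exchange_big mulr_sumr; apply: eq_bigr => j _ /=.
  have ij : (i + j < m + m)%N by rewrite -addSn leq_add// ltnW.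
  by rewrite -big_mkcond (big_pred1 (Ordinal ij))//= mulrACA exprD.
have small i j : (i < m)%N -> (j < m)%N -> (i < k)%N || (j < l)%N ->
    tau ^+ (i + j) * gauss 1 (a i * b j) < tau ^+ (k + l) * (c * d).
  move=> im jm ijkl; rewrite [tau ^+ (k + l)]exprD [ltRHS]mulrACA.
  apply: (@le_lt_trans _ _ ((tau ^+ i * gauss 1 (a i)) * (tau ^+ j * gauss 1 (b j)))).
    by rewrite mulrACA -exprD ler_wpM2l// gaussM.
  have ai0 : 0 <= tau ^+ i * gauss 1 (a i) by rewrite mulr_ge0// (nonarch_ge0 oneN).
  case/orP: ijkl => [ik|jl].
    apply: (@le_lt_trans _ _ ((tau ^+ i * gauss 1 (a i)) * (tau ^+ l * d))).
      by rewrite ler_wpM2l// le_l.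
    by rewrite ltr_pM2r// lt_k.
  apply: (@le_lt_trans _ _ ((tau ^+ k * c) * (tau ^+ j * gauss 1 (b j)))).
    by rewrite ler_wpM2r ?le_k// mulr_ge0// (nonarch_ge0 oneN).
  by rewrite ltr_pM2l// lt_l.
have scaleN n : @nonarch_seminorm K W (fun x => tau ^+ n * gauss 1 x).
  exact: nonarchZ.
(* The terms of total index k + l other than a_k b_l; each has i < k or j < l, so [small]
   applies. *)
pose w := \sum_(i < m | i != k :> nat) \sum_(j < m | (i + j == k + l)%N) a i * b j.
have zE : z (k + l)%N = a k * b l + w.
  rewrite /z (bigD1 (Ordinal km))//=; congr (_ + _).
  rewrite (big_pred1 (Ordinal lm))// => j.
  by rewrite eqn_add2l.
have wlt : gauss 1 w < c * d.
  suff : tau ^+ (k + l) * gauss 1 w < tau ^+ (k + l) * (c * d).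
    rewrite ltNge => h; rewrite ltNge; apply/negP => /(ler_wpM2l (tauX_ge0 (k + l))).
    by apply/negP.
  apply: (nonarch_sum_lt (scaleN _)) => // i ik; apply: (nonarch_sum_lt (scaleN _)) => // j /eqP ij.
  rewrite -{1}ij; apply: small => //.
  exact: addn_eq_lt_or ij ik.
have abE : gauss 1 (a k * b l) = c * d.
  apply/eqP; rewrite eq_le gaussM//= -ak -bl.
  case: gammaP => _ _ <-; rewrite -(tcoef0M perfR); exact: gauss_tcoef0.
have zc : gauss 1 (z (k + l)%N) = c * d.
  by rewrite zE (nonarch_dominant oneN) abE.
rewrite XY; apply: (@le_trans _ _ (tau ^+ (k + l) * (c * d))).
  by rewrite exprD mulrACA ler_pM ?witt_H_ge0.
apply: witt_H_dominated_ge => //.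
- by rewrite -addSn leq_add// ltnW.
- by rewrite mulr_gt0.
- have gab : gamma (tcoef (a k * b l) 0) = c * d.
    by rewrite (tcoef0M perfR); case: gammaP => _ _ ->; rewrite ak bl.
  rewrite zE (tcoef0D perfR) (nonarch_dominant gammaN) gab//.
  by apply: le_lt_trans wlt; exact: gauss_tcoef0.
move=> n nkl; apply: (nonarch_sum_lt (scaleN _)) => // i _.
apply: (nonarch_sum_lt (scaleN _)) => // j /eqP ij.
by rewrite -{1}ij; apply: small => //; apply: addn_lt_or; rewrite ij.
Qed.

Lemma witt_HM x y : H (x * y) = H x * H y.
Proof.
have HN := witt_H_nonarch; have H0 := witt_H_ge0.
apply/eqP; rewrite eq_le witt_HM_le leNgt; apply/negP => lt_xy.
have xy0 := le_lt_trans (H0 (x * y)) lt_xy.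
have H1 u : H u <= 1 by apply: le_trans (witt_H_le_gauss u) _; exact: gauss_le1.
(* H is at most 1, so a precision e below H x * H y is also below each factor; all remainders are
   then negligible. *)
have [n] := expr_lt_eps (ltW q_gt0) q_lt1 xy0; set e := q ^+ n => exy.
have e0 : 0 < e by exact: exprn_gt0.
have ex : e < H x by apply: lt_le_trans exy _; rewrite ler_piMr.
have ey : e < H y by apply: lt_le_trans exy _; rewrite ler_piMl.
have [a [z xE]] := wred_expansion charR perfR vP n n x.
have [b [z' yE]] := wred_expansion charR perfR vP n n y.
set X := \sum_(k < n) _ in xE; set Y := \sum_(k < n) _ in yE.
have good (s : nat -> W) k : gauss 1 (iter n (wred varpi v) (s k)) <=
    Num.max (gamma (tcoef (iter n (wred varpi v) (s k)) 0)) e.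
  exact: gauss1_iter_wred.
have HX : H X = H x.
  have -> : X = x - z * varpi ^+ n by rewrite xE addrK.
  by rewrite (nonarch_dominant HN)// (nonarchN HN) (le_lt_trans (witt_H_tail _ _)).
have HY : H Y = H y.
  have -> : Y = y - z' * varpi ^+ n by rewrite yE addrK.
  by rewrite (nonarch_dominant HN)// (nonarchN HN) (le_lt_trans (witt_H_tail _ _)).
have XYE : X * Y = x * y - (z * y + X * z') * varpi ^+ n.
  by rewrite yE xE; ring.
have : H X * H Y <= H (X * Y).
  apply: (@witt_HM_dominated (fun k => iter n (wred varpi v) (a k))
    (fun k => iter n (wred varpi v) (b k)) n e) => //.
    by rewrite HX.
  by rewrite HY.
rewrite HX HY leNgt => /negP; apply.
rewrite XYE; apply: (nonarchD_lt HN) => //.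
by rewrite (nonarchN HN) (le_lt_trans (witt_H_tail _ _)).
Qed.

Lemma witt_H_multiplicative : multiplicative_seminorm H.
Proof.
split; [exact: witt_H_nonarch | | exact: witt_HM].
by apply: le_trans (witt_H_le_gauss 1) _; exact: gauss_le1.
Qed.
End WittH.

(** * Continuity for the topology of pointwise convergence *)

Lemma ptws_cvg (I : Type) (V : topologicalType) (T : Type) (F : set_system T)
    (FF : Filter F) (f : T -> {ptws I -> V}) (l : {ptws I -> V}) :
  (forall i, f x i @[x --> F] --> l i) -> f x @[x --> F] --> l.
Proof.
move=> fl; apply/cvg_sup => i U [A [[B oB <-] Bl AU]].
by apply: filterS AU _; apply: fl; exact: open_nbhs_nbhs.
Qed.

Lemma continuous_bigmax_ord (K : realType) (T : topologicalType) m
    (f : nat -> T -> K) : (forall k, continuous (f k)) ->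
  continuous (fun x => \big[Num.max/0]_(k < m) f k x).
Proof.
elim: m f => [|m IH] f cf x.
  under eq_fun do rewrite big_ord0; exact: cvg_cst.
under eq_fun do rewrite big_ord_recl.
by apply: continuous_max; [exact: cf | exact: (IH (fun k => f k.+1))].
Qed.

Lemma continuous_weighted_eval (K : realType) (I : eqType) (c : K) k (i : I) :
  continuous (fun gt : {ptws I -> K} * K => (gt.2 / c) ^+ k * gt.1 i).
Proof.
have hK : continuous (fun r : K => (r / c) ^+ k).
  move=> r; apply: (@continuous_comp K K K (fun r => r / c) (fun r => r ^+ k)).
    exact: mulrr_continuous.
  exact: exprn_continuous.
have h1 : continuous ((fun r : K => (r / c) ^+ k) \o (snd : {ptws I -> K} * K -> K)).
  move=> gt; apply: (@continuous_comp _ K K).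
    exact: cvg_snd.
  exact: hK.
have h2 : continuous ((fun g : {ptws I -> K} => g i) \o (fst : {ptws I -> K} * K -> {ptws I -> K})).
  move=> gt; apply: (@continuous_comp _ {ptws I -> K} K).
    exact: cvg_fst.
  exact: (@proj_continuous I (fun=> K)).
move=> gt; exact: (cvgM (h1 gt) (h2 gt)).
Qed.

Lemma continuous_max_weighted_eval (K : realType) (I : eqType) (c : K) n
    (y : nat -> I) :
  continuous (fun gt : {ptws I -> K} * K =>
    \big[Num.max/0]_(k < n) ((gt.2 / c) ^+ k * gt.1 (y k))).
Proof.
exact: (@continuous_bigmax_ord K ({ptws I -> K} * K)%type n
  (fun k gt => (gt.2 / c) ^+ k * gt.1 (y k))
  (fun k => @continuous_weighted_eval K I c k (y k))).
Qed.

(** Turns [witt_H_estimate] into a uniform approximation: two numbers that differ after truncation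
    from below at e is excluded, so either they coincide or both lie in [0, e]. *)
Lemma maxr_eq_dist (K : realType) (a b e : K) : 0 <= a -> 0 <= b -> 0 <= e ->
  Num.max a e = Num.max b e -> `|a - b| <= e.
Proof.
move=> a0 b0 e0; rewrite ler_norml.
by case: (leP a e) => ae; case: (leP b e) => be ab; apply/andP; split; lra.
Qed.

Theorem theorem7p1 (K : realType) (p : nat) (pr : prime p) (R : comPzRingType)
    (charR : p%:R = 0 :> R) (perfR : perfect p R)
    (alpha : R -> K) (alpha_norm : power_multiplicative_norm alpha)
    (alpha_le1 : forall r : R, alpha r <= 1)
    (varpi : witt pr R)
    (varpi0 : alpha (tcoef varpi 0) <= p%:R^-1)
    (varpi1 : exists u : R, u * tcoef varpi 1 = 1) :
  let H (gt : {ptws R -> K} * K) : {ptws witt pr R -> K} :=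
    witt_H gt.1 varpi gt.2 in
  let dom := berkovich alpha `*` `[0, 1] in
  set_fun dom (berkovich (witt_lambda alpha : witt pr R -> K)) H /\
  {within dom, continuous H}.
Proof.
move=> H dom; have [u u1] := varpi1.
(* The leading digit of [wtail varpi] is the digit varpi_1, invertible by hypothesis. *)
have [v vP] : exists v, v * wtail varpi = 1.
  by apply: (witt_unit charR perfR (a := u)); rewrite tcoef_wtail.
have domP gt : dom gt -> [/\ multiplicative_seminorm (gt.1 : R -> K),
    forall r, gt.1 r <= 1, gt.1 (tcoef varpi 0) <= p%:R^-1, 0 <= gt.2 & gt.2 <= 1].
  move=> [[gm ga] /=]; rewrite in_itv /= => /andP[t0 t1]; split=> //.
    by move=> r; exact: le_trans (ga r) (alpha_le1 r).
  exact: le_trans (ga _) varpi0.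
split.
  move=> gt gdom; have [gm g1 g0 t0 t1] := domP _ gdom; split.
    exact: (witt_H_multiplicative charR perfR gm g1 vP g0 t0 t1).
  move=> x; apply: le_trans (witt_H_le_gauss perfR gm g1 varpi t0 x) _.
  (* Monotonicity of lambda, term by term; as alpha <= 1, the terms for alpha are bounded by 1, so
     their supremum bounds each of them. *)
  rewrite -witt_lambdaE; apply: ge_sup; first by eexists; exists 0%N.
  have ga : forall a, gt.1 a <= alpha a by case: gdom => -[].
  move=> _ [i _ <-]; apply: (@le_trans _ _ (p%:R ^- i * alpha (tcoef x i))).
    by rewrite ler_wpM2l ?ga// invr_ge0 exprn_ge0.
  apply: ub_le_sup; last by exists i.
  have q_le1 : (p%:R^-1 : K) <= 1 by rewrite invf_le1 ?ltr0n ?prime_gt0// ler1n prime_gt0.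
  have alpha_ge0 r : 0 <= alpha r by case: alpha_norm => -[[]].
  exists 1 => _ [j _ <-]; rewrite -exprVn.
  by rewrite mulr_ile1 ?exprn_ge0 ?exprn_ile1 ?invr_ge0.
apply/subspace_continuousP => gt0 gt0dom; apply: ptws_cvg => x.
apply/cvgrPdist_lt => e e0; have e3 : 0 < e / 3 by rewrite divr_gt0.
have [n qn] : exists n, (p%:R^-1 : K) ^+ n < e / 3.
  by apply: expr_lt_eps => //; rewrite ?invr_ge0// invf_lt1 ?ltr0n ?prime_gt0// ltr1n prime_gt1.
(* The expansion is fixed before the point of [dom] varies, so D is one continuous function within e
   / 3 of the value of H at x on all of [dom]. *)
have [y [z xE]] := wred_expansion charR perfR vP n n x.
pose Y k := tcoef (iter n (wred varpi v) (y k)) 0.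
pose D (gt : {ptws R -> K} * K) : K :=
  \big[Num.max/0]_(k < n) ((gt.2 / p%:R) ^+ k * gt.1 (Y k)).
have DH gt : dom gt -> `|H gt x - D gt| <= e / 3.
  move=> /domP[gm g1 g0 t0' t1].
  apply: maxr_eq_dist; [exact: witt_H_ge0|exact: bigmax_ge_id|exact: ltW|].
  apply: (witt_H_estimate charR perfR gm g1 vP g0 t0' t1 e3 (ltW qn) xE
    (y := fun k => iter n (wred varpi v) (y k))) => k kn.
  apply: le_trans (gauss1_iter_wred charR perfR gm g1 v g0 n (y k)) _.
  by rewrite ge_max !le_max lexx (ltW qn) orbT.
have Dnear : \forall gt \near within dom (nbhs gt0), `|D gt0 - D gt| < e / 3.
  by apply: cvg_within; move/cvgrPdist_lt : (@continuous_max_weighted_eval K R p%:R n Y gt0); exact.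
have domnear : \forall gt \near within dom (nbhs gt0), dom gt by exact: withinT.
near=> gt; have gtdom : dom gt by near: gt.
have -> : H gt0 x - H gt x =
  (H gt0 x - D gt0) + (D gt0 - D gt) - (H gt x - D gt) by ring.
apply: le_lt_trans (ler_normB _ _) _; apply: le_lt_trans (lerD (ler_normD _ _) (lexx _)) _.
have h1 := DH _ gt0dom; have h2 := DH _ gtdom.
have h3 : `|D gt0 - D gt| < e / 3 by near: gt.
by rewrite [ltRHS](_ : e = e / 3 + e / 3 + e / 3); [rewrite ltr_leD// ler_ltD|lra].
Unshelve. all: by end_near. Qed.
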